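(* Let $G$ be a chordal graph on $N$ vertices with at least two maximal cliques, let $\Delta$ be its clique complex, with facets $S_1,\ldots,S_e$ in a fixed leaf order, facet cardinalities $n_m=|S_m|$ and separator cardinalities $r_1,\ldots,r_{e-1}$. For $-1\le k<N-3$, set $$\tau_k=\binom{N-1}{k+1}-\sum_{m=1}^e\binom{n_m-1}{N-k-2}+\sum_{m=1}^{e-1}\binom{r_m-1}{N-k-2}$$ and $A_k=\mathbb K[(\Delta^\vee)_{(k)}]$. For $0\le k\le N-5$, $$\tau_k\ge\binom{N-3}{k+1}\ge2.$$ If $N\ge4$ and $c$ is the number of connected components of $G$, then at the last proper skeleton $$\tau_{N-4}=|E(\overline G)|-c+1.$$ For $0\le k<N-3$, the following conditions are equivalent: (i) $A_k$ is Gorenstein; (ii) $\tau_k=1$; (iii) $k=N-4$, $e=2$, $n_1=n_2=N-1$, and $r_1=N-2$; (iv) $\Delta^\vee$ is a simplex on $N-2$ vertices, with the remaining two vertices ghost, and $(\Delta^\vee)_{(k)}$ is the boundary of that simplex; (v) $k=N-4$ and $G=K_N\setminus\{uv\}$ for some distinct vertices $u,v$ (the complete graph with one edge removed). In every other case with $0\le k<N-3$, $\tau_k\ge2$.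
   Context: $\mathbb K$ is a field. For a finite set $X$ with $|X|=N$, put $R=\mathbb K[x:x\in X]$ with the standard grading. A simplicial complex $\Sigma$ on $X$ is a collection of subsets (faces) of $X$ closed under inclusion; elements of $X$ not lying in any face are called ghost vertices and are allowed. A face $F$ has dimension $|F|-1$. The $k$-skeleton $\Sigma_{(k)}$ consists of all faces of dimension at most $k$, viewed as a complex on the same set $X$; $\Sigma_{(-1)}=\{\varnothing\}$. The Alexander dual on $X$ is $\Sigma^\vee=\{F\subseteq X:X\setminus F\notin\Sigma\}$. $I_\Sigma\subseteq R$ is generated by the monomials $\prod_{x\in A}x$ with $A\subseteq X$, $A\notin\Sigma$; $\mathbb K[\Sigma]=R/I_\Sigma$. $\overline G$ is the complement graph and $E(\overline G)$ its edge set. The clique complex $\Delta$ of the finite graph $G$ with vertex set $X$, $|X|=N$, consists of its cliques; its facets are the maximal cliques. A leaf order of the facets is an ordering $S_1,\ldots,S_e$ such that for each $m\ge2$ there is $p(m)<m$ satisfying $S_m\cap S_i\subseteq S_m\cap S_{p(m)}$ for all $i<m$; such an order exists when $G$ is chordal. For $1\le m\le e-1$ the separators are $Q_m=(S_1\cup\cdots\cup S_m)\cap S_{m+1}=S_{p(m+1)}\cap S_{m+1}$ (possibly empty), and $r_m=|Q_m|$. One has $\dim\Delta^\vee=N-3$. Binomial convention: $\binom ab=0$ if $a<0$, $b<0$ or $b>a$; otherwise it is the usual binomial coefficient. *)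

(* Defs.v *)
From HB Require Import structures.
From mathcomp Require Import all_boot all_order all_algebra.
From mathcomp Require Import mpoly.

Set Implicit Arguments.
Unset Strict Implicit.
Unset Printing Implicit Defensive.

Import GRing.Theory Num.Theory.
Local Open Scope ring_scope.

Definition binz (a b : int) : int :=
  match a, b with
  | Posz a', Posz b' => 'C(a', b')%:Z
  | _, _ => 0
  end.

Section Complexes.
Variable X : finType.
Implicit Types (Sigma : {set {set X}}) (F V : {set X}).

Definition facets Sigma : {set {set X}} := [set F | maxset (mem Sigma) F].

Definition skeleton Sigma (k : int) : {set {set X}} :=
  [set F in Sigma | #|F|%:Z - 1 <= k].

Definition alexander_dual Sigma : {set {set X}} :=
  [set F | ~: F \notin Sigma].

Definition ghost Sigma (x : X) : Prop := forall F, F \in Sigma -> x \notin F.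

Definition simplex_on V : {set {set X}} := powerset V.

Definition simplex_boundary V : {set {set X}} := powerset V :\ V.

Definition leaf_order Sigma (S : seq {set X}) : Prop :=
  [/\ uniq S, S =i facets Sigma
    & forall m, (0 < m < size S)%N ->
        exists2 p, (p < m)%N & forall i, (i < m)%N ->
          nth set0 S m :&: nth set0 S i \subset nth set0 S m :&: nth set0 S p].

(* With S = [:: S_1; ...; S_e], the set S_{m+1} is [nth set0 S m], so this is
   Q_m = (S_1 U ... U S_m) n S_{m+1}, for 1 <= m <= e - 1. *)
Definition separator (S : seq {set X}) (m : nat) : {set X} :=
  (\bigcup_(T <- take m S) T) :&: nth set0 S m.

Definition tau (S : seq {set X}) (k : int) : int :=
  let N := #|X|%:Z in
  binz (N - 1) (k + 1)
  - \sum_(T <- S) binz (#|T|%:Z - 1) (N - k - 2)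
  + \sum_(1 <= m < size S) binz (#|separator S m|%:Z - 1) (N - k - 2).

End Complexes.

Section Graphs.
Variable X : finType.
Implicit Type adj : rel X.

Definition clique_complex adj : {set {set X}} :=
  [set A : {set X} | [forall x in A, forall y in A, (x != y) ==> adj x y]].

(* The last two conditions say that x and y are not consecutive on the cycle;
   x != y is automatic for an irreflexive relation. *)
Definition chordal adj : Prop :=
  forall c : seq X, (4 <= size c)%N -> uniq c -> cycle adj c ->
    exists x y, [/\ x \in c, y \in c, adj x y, y != next c x & x != next c y].

Definition compl_graph adj : rel X := fun x y => (x != y) && ~~ adj x y.

Definition edges adj : {set {set X}} :=
  [set A : {set X} | [exists x, exists y, adj x y && (A == [set x; y])]].

Definition num_components adj : nat := n_comp adj predT.

End Graphs.

(* A quotient P / I is represented by I; its ideals by those of P containing I. *)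
Section Quotients.
Variables (K : fieldType) (n : nat).
Local Notation P := {mpoly K[n]}.
Implicit Types (I J V : P -> Prop) (theta : seq P).

Definition ideal_gen (gens : P -> Prop) : P -> Prop := fun p =>
  exists2 s : seq (P * P), (forall u, u \in s -> gens u.2)
                         & p = \sum_(u <- s) u.1 * u.2.

Definition ideal_add I theta : P -> Prop :=
  ideal_gen (fun p => I p \/ p \in theta).

Definition is_ideal I : Prop :=
  [/\ I 0, forall p q, I p -> I q -> I (p + q) & forall a p, I p -> I (a * p)].

Definition prime_ideal I : Prop :=
  [/\ is_ideal I, ~ I 1 & forall p q, I (p * q) -> I p \/ I q].

Definition has_prime_chain I (d : nat) : Prop :=
  exists Q : nat -> P -> Prop,
    [/\ forall i, (i <= d)%N -> prime_ideal (Q i),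
        forall i p, (i <= d)%N -> I p -> Q i p
      & forall i, (i < d)%N ->
          (forall p, Q i p -> Q i.+1 p) /\ (exists2 p, Q i.+1 p & ~ Q i p)].

(* d is the Krull dimension of P / I *)
Definition krull_dim I (d : nat) : Prop :=
  has_prime_chain I d /\ forall d', has_prime_chain I d' -> (d' <= d)%N.

(* \dim_K (V / J) = t, for K-subspaces J of V *)
Definition quot_dim V J (t : nat) : Prop :=
  exists b : 'I_t -> P,
    [/\ forall i, V (b i),
        forall p, V p -> exists a : 'I_t -> K, J (p - \sum_i a i *: b i)
      & forall a : 'I_t -> K, J (\sum_i a i *: b i) -> forall i, a i = 0].

(* theta is a homogeneous system of parameters of P / I *)
Definition hsop I theta : Prop :=
  [/\ forall f, f \in theta -> exists2 d, (0 < d)%N & f \is d.-homog,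
      krull_dim I (size theta)
    & exists t, quot_dim (fun _ => True) (ideal_add I theta) t].

Definition regular_seq I theta : Prop :=
  ~ ideal_add I theta 1 /\
  forall i, (i < size theta)%N -> forall g,
    ideal_add I (take i theta) (nth 0 theta i * g) ->
    ideal_add I (take i theta) g.

(* preimage in P of the socle (0 : (x_1, ..., x_n)) of P / J *)
Definition socle J : P -> Prop := fun p => forall i : 'I_n, J ('X_i * p).

(* P / I is Cohen-Macaulay of type t.  For a Cohen-Macaulay graded algebra
   every homogeneous system of parameters is a regular sequence and the socle
   dimension does not depend on its choice, hence the single existential. *)
Definition cm_of_type I (t : nat) : Prop :=
  exists theta, [/\ hsop I theta, regular_seq I theta
    & quot_dim (socle (ideal_add I theta)) (ideal_add I theta) t].

Definition gorenstein I : Prop := cm_of_type I 1.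

End Quotients.

(* The variable attached to x : X is 'X_(enum_rank x). *)
Definition sqfree_monomial (K : fieldType) (X : finType) (A : {set X}) :
  {mpoly K[#|X|]} := \prod_(x in A) 'X_(enum_rank x).

Definition sr_ideal (K : fieldType) (X : finType) (Sigma : {set {set X}}) :
  {mpoly K[#|X|]} -> Prop :=
  ideal_gen (fun p => exists2 A, A \notin Sigma & p = sqfree_monomial K A).

Arguments sr_ideal K {X} Sigma _.

(* Main.v *)
Require Import Defs.
From HB Require Import structures.
From mathcomp Require Import all_boot all_order all_algebra.
From mathcomp Require Import mpoly.
From mathcomp Require Import zify ring.
From Stdlib Require Import Classical.

Set Implicit Arguments.
Unset Strict Implicit.
Unset Printing Implicit Defensive.

Import GRing.Theory Num.Theory.
Local Open Scope ring_scope.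

(** The type of a Cohen-Macaulay graded ring is the socle dimension of an artinian
    reduction, so it is at least the dimension of the last nonzero degree of that
    reduction. Comparing Hilbert series shows that for the face ring of a complex of
    dimension at most d - 1 it is, up to sign, the coefficient of t^d in the
    h-polynomial if this is nonzero ([cm_type_bound]). For the [k]-skeleton of the dual and d = k + 1
    this coefficient is an alternating sum over the faces, hence over the cliques of
    the graph. A leaf order builds the clique complex by gluing each facet along the
    full simplex on its separator, so such sums are additive along the order
    ([valuation_faces_upto]), and the coefficient turns out to be tau
    ([top_h_skeleton]).

    The same order gives the lower bounds. Put j = N - k - 2. The gluing of a facet
    with n vertices to a union of a vertices along r of them changes tau by
    C(a + n - r - 1, j) - C(a - 1, j) - C(n - 1, j) + C(r - 1, j), which counts
    j-subsets lying in neither part; this is nonnegative, and the last step alone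
    contributes at least C(N - 3, j - 2) = C(N - 3, k + 1) ([bin_glue_leq]). So tau is
    positive, a Gorenstein skeleton has tau = 1, and tau is at least 2 when j > 2.
    For j = 2 each step past two vertices contributes at least one, so tau = 1 leaves
    room for a single step, with a = n = r + 1 ([partial_tau_eq1]): the graph is
    complete but for one edge, and the dual is a simplex on the other vertices.
    The value of tau for j = 2 in terms of edges and components comes from counting
    edges and vertices by the same additivity; a component begins at every facet with
    empty separator ([num_components_leaf_order]).

    It remains that the boundary of a simplex on V is Gorenstein, with any number of
    ghost vertices ([gorenstein_boundary]). The differences x_w - x_v, for a fixed
    vertex v, form a regular sequence, because modulo the first of them the
    ideal becomes that of one monomial in the remaining variables of V, and no
    variable divides the next difference; the reduction is K[t]/(t^|V|), whose socle
    is a line. The Krull dimension is bounded by growth: along a chain of d + 1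
    primes one finds d elements whose monomials are independent modulo the smallest
    prime ([chain_free_family]). *)

(** * Linear algebra modulo a subspace *)

Section Modulo.
Variables (K : fieldType) (n : nat).
Local Notation P := {mpoly K[n]}.
Implicit Types (J V W : P -> Prop) (p : P).

Definition subspace J : Prop :=
  [/\ J 0, forall p q, J p -> J q -> J (p + q)
    & forall (c : K) p, J p -> J (c *: p)].

Definition free_mod J (T : finType) (b : T -> P) : Prop :=
  forall a : T -> K, J (\sum_t a t *: b t) -> forall t, a t = 0.

Definition spans_mod J (T : finType) (b : T -> P) p : Prop :=
  exists a : T -> K, J (p - \sum_t a t *: b t).

Lemma subspaceN J p : subspace J -> J p -> J (- p).
Proof. by case=> _ _ JZ Jp; rewrite -scaleN1r; apply: JZ. Qed.

Lemma subspaceB J p q : subspace J -> J p -> J q -> J (p - q).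
Proof. by move=> sJ Jp Jq; case: (sJ) => _ JD _; apply: JD => //; apply: subspaceN. Qed.

Lemma subspaceBK J p q : subspace J -> J (p - q) -> J q -> J p.
Proof. by move=> sJ Jpq Jq; case: (sJ) => _ JD _; rewrite -(subrK q p); apply: JD. Qed.

Lemma subspace_sum J (I : Type) (r : seq I) (A : pred I) (F : I -> P) :
  subspace J -> (forall i, A i -> J (F i)) -> J (\sum_(i <- r | A i) F i).
Proof. by case=> J0 JD _ JF; apply: big_ind. Qed.

(** The coefficients of the family [b] over [g] form a matrix with more rows than
    columns if #|U| < #|T|; a nonzero row vector killed by it is a relation. *)
Lemma free_mod_leq_card J (T U : finType) (b : T -> P) (g : U -> P) :
  subspace J -> free_mod J b -> (forall t, spans_mod J g (b t)) ->
  (#|T| <= #|U|)%N.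
Proof.
move=> sJ freeb spang; have [A bA] := fin_all_exists spang.
rewrite leqNgt; apply/negP => ltUT.
pose M := \matrix_(i < #|T|, j < #|U|) A (enum_val i) (enum_val j).
have kerM0 : kermx M != 0.
  rewrite -mxrank_eq0 mxrank_ker -lt0n subn_gt0.
  exact: leq_ltn_trans (rank_leq_col M) ltUT.
pose v := nz_row (kermx M).
have vM0 : v *m M = 0 by apply/sub_kermxP; apply: nz_row_sub.
have v0 : v != 0 by rewrite nz_row_eq0.
pose c t := v 0 (enum_rank t).
have c0 : forall t, c t = 0.
  apply: freeb.
  have -> : \sum_t c t *: b t = \sum_t c t *: (b t - \sum_u A t u *: g u).
    symmetry; under eq_bigr do rewrite scalerBr scaler_sumr.
    rewrite sumrB -[RHS]subr0; congr (_ - _).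
    rewrite exchange_big big1 //= => u _.
    under eq_bigr do rewrite scalerA.
    rewrite -scaler_suml -[RHS](scale0r (g u)); congr (_ *: _).
    have /matrixP/(_ 0 (enum_rank u)) := vM0; rewrite !mxE => vMu.
    rewrite -[RHS]vMu (reindex (@enum_val T predT)) /=; last first.
      by apply: onW_bij; apply: enum_val_bij.
    by apply: eq_bigr => i _; rewrite mxE /c enum_valK enum_rankK.
  by apply: subspace_sum => // t _; case: sJ => _ _ JZ; apply: JZ.
case/negP: v0; apply/eqP/rowP => i; rewrite mxE -(c0 (enum_val i)).
by rewrite /c enum_valK.
Qed.

Lemma big_enum_val_card (T : finType) (F : T -> P) :
  \sum_(i < #|T|) F (enum_val i) = \sum_t F t.
Proof. by rewrite -big_enum_val. Qed.

Lemma quot_dim_basis V J (T : finType) (b : T -> P) :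
  (forall t, V (b t)) -> (forall p, V p -> spans_mod J b p) -> free_mod J b ->
  quot_dim V J #|T|.
Proof.
move=> Vb spanb freeb; exists (fun i => b (enum_val i)); split=> // [p /spanb[a Ja] | a].
  by exists (fun i => a (enum_val i)); rewrite (big_enum_val_card (fun t => a t *: b t)).
move=> Ja i; rewrite -(enum_valK i); apply: (freeb (fun t => a (enum_rank t))).
by rewrite -big_enum_val_card /=; under eq_bigr do rewrite enum_valK.
Qed.

Lemma quot_dim_free_leq V J t (T : finType) (b : T -> P) :
  subspace J -> quot_dim V J t -> (forall i, V (b i)) -> free_mod J b ->
  (#|T| <= t)%N.
Proof.
move=> sJ [g [Vg spang _]] Vb freeb; rewrite -[t]card_ord.
by apply: (free_mod_leq_card sJ freeb (g := g)) => i; apply/spang/Vb.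
Qed.

Lemma quot_dim_leq V V' J t t' : subspace J -> (forall p, V p -> V' p) ->
  quot_dim V J t -> quot_dim V' J t' -> (t <= t')%N.
Proof.
move=> sJ VV' [b [Vb _ freeb]] dV'; rewrite -[t]card_ord.
by apply: (quot_dim_free_leq sJ dV' _ freeb) => i; apply/VV'/Vb.
Qed.

Lemma quot_dim_uniq V J t t' : subspace J ->
  quot_dim V J t -> quot_dim V J t' -> t = t'.
Proof.
move=> sJ d d'; apply/eqP; rewrite eqn_leq.
by rewrite (quot_dim_leq sJ _ d d') // (quot_dim_leq sJ _ d' d).
Qed.

Definition cat_fam (A : Type) s t (b : 'I_s -> A) (c : 'I_t -> A)
  (i : 'I_(s + t)) : A :=
  match split i with inl j => b j | inr j => c j end.

Lemma cat_famL A s t (b : 'I_s -> A) (c : 'I_t -> A) i :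
  cat_fam b c (lshift t i) = b i.
Proof. by rewrite /cat_fam -[lshift t i]/(unsplit (inl i)) unsplitK. Qed.

Lemma cat_famR A s t (b : 'I_s -> A) (c : 'I_t -> A) i :
  cat_fam b c (rshift s i) = c i.
Proof. by rewrite /cat_fam -[rshift s i]/(unsplit (inr i)) unsplitK. Qed.

Lemma cat_fam_sum s t (b : 'I_s -> P) (c : 'I_t -> P) (a : 'I_(s + t) -> K) :
  \sum_i a i *: cat_fam b c i
    = \sum_i a (lshift t i) *: b i + \sum_i a (rshift s i) *: c i.
Proof.
rewrite big_split_ord /=; congr (_ + _); apply: eq_bigr => i _.
  by rewrite cat_famL.
by rewrite cat_famR.
Qed.

Lemma cat_fam0 s t (a : 'I_(s + t) -> K) :
  (forall i, a (lshift t i) = 0) -> (forall i, a (rshift s i) = 0) ->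
  forall i, a i = 0.
Proof. by move=> a1 a2 i; rewrite -(splitK i); case: (split i). Qed.

Lemma quot_dim_trans V W J s t : subspace J -> subspace W ->
  (forall p, J p -> W p) -> (forall p, W p -> V p) ->
  quot_dim V W s -> quot_dim W J t -> quot_dim V J (s + t).
Proof.
move=> sJ sW JW WV [b [Vb spanb freeb]] [c [Wc spanc freec]].
exists (cat_fam b c); split.
- by move=> i; rewrite /cat_fam; case: (split i) => j; [apply: Vb | apply/WV/Wc].
- move=> p /spanb[a1 /spanc[a2 J12]].
  exists (cat_fam a1 a2); rewrite cat_fam_sum.
  rewrite (eq_bigr (fun i => a1 i *: b i)) => [|i _]; last by rewrite cat_famL.
  rewrite [X in _ - (_ + X)](eq_bigr (fun i => a2 i *: c i)) => [|i _];
    last by rewrite cat_famR.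
  by rewrite opprD addrA.
move=> a; rewrite cat_fam_sum => Ja.
have Wbc := JW _ Ja.
have a1 : forall i, a (lshift t i) = 0.
  apply: freeb; rewrite -[X in W X](addrK (\sum_i a (rshift s i) *: c i)).
  apply: subspaceB => //; apply: subspace_sum => // i _.
  by case: sW => _ _; apply.
apply: cat_fam0 (a1) _; apply: freec; move: Ja; rewrite big1 ?add0r // => i _.
by rewrite a1 scale0r.
Qed.

(** Multiplication by a polynomial that is injective modulo [J] carries a
    basis of [V] modulo [J] to one of its image. *)
Lemma quot_dim_mull V W J (f : P) t : subspace J ->
  (forall p, V p -> W (p * f)) ->
  (forall p, W p -> exists2 q, V q & J (p - q * f)) ->
  (forall q, J (q * f) <-> J q) ->
  quot_dim V J t -> quot_dim W J t.
Proof.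
move=> sJ VW WV inj [b [Vb spanb freeb]].
have sumf a : \sum_i a i *: (b i * f) = (\sum_i a i *: b i) * f.
  by rewrite mulr_suml; apply: eq_bigr => i _; rewrite scalerAl.
exists (fun i => b i * f); split=> [i | p /WV[q Vq Jpq] | a].
- exact/VW/Vb.
- have [a Ja] := spanb _ Vq; exists a; rewrite sumf.
  rewrite -(subrK (q * f) p) -addrA -mulrBl.
  by case: sJ => _ JD _; apply: JD => //; apply/inj.
by rewrite sumf => /inj/freeb.
Qed.

(** An independent family of maximal size is a basis. *)
Lemma quot_dim_exists V J t : subspace J -> subspace V ->
  (forall (s : nat) (b : 'I_s -> P),
     (forall i, V (b i)) -> free_mod J b -> (s <= t)%N) ->
  exists s, quot_dim V J s.
Proof.
move=> sJ sV bnd.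
pose indep s := exists2 b : 'I_s -> P, forall i, V (b i) & free_mod J b.
have [s [[b Vb freeb] maxs]] : exists s, indep s /\ ~ indep s.+1.
  apply: NNPP => noMax.
  have all_indep : forall s, indep s.
    elim=> [|s IH]; last by apply: NNPP => NI; apply: noMax; exists s.
    by exists (fun _ => 0) => [[]|a _ []].
  have [b Vb /(bnd _ _ Vb)] := all_indep t.+1; by rewrite ltnn.
exists s, b; split=> // p Vp; apply: NNPP => nspan; apply: maxs.
rewrite -addn1; exists (cat_fam b (fun _ : 'I_1 => p)).
  by move=> i; rewrite /cat_fam; case: (split i).
move=> a; rewrite cat_fam_sum big_ord1 => Ja.
have a0 : a (rshift s ord0) = 0.
  apply/eqP/negPn/negP => anz; apply: nspan.
  exists (fun i => - (a (rshift s ord0))^-1 * a (lshift 1 i)).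
  case: sJ => _ _ /(_ (a (rshift s ord0))^-1 _ Ja).
  rewrite scalerDr scalerA mulVf // scale1r addrC scaler_sumr -sumrN.
  by under [in X in _ -> X]eq_bigr do rewrite mulNr scaleNr opprK -scalerA.
apply: cat_fam0; last by move=> i; rewrite ord1.
by apply: freeb; move: Ja; rewrite a0 scale0r addr0.
Qed.

End Modulo.

(** * Ideals *)

Section Ideals.
Variables (K : fieldType) (n : nat).
Local Notation P := {mpoly K[n]}.
Implicit Types (I J G V : P -> Prop) (theta : seq P) (p q f g : P).

Lemma ideal_sum I (A : Type) (r : seq A) (B : pred A) (F : A -> P) :
  is_ideal I -> (forall i, B i -> I (F i)) -> I (\sum_(i <- r | B i) F i).
Proof. by case=> I0 ID _ IF; apply: big_ind. Qed.

Lemma ideal_subspace I : is_ideal I -> subspace I.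
Proof. by case=> I0 ID IM; split=> // c p Ip; rewrite -mul_mpolyC; apply: IM. Qed.

Lemma ideal_gen_ideal G : is_ideal (ideal_gen G).
Proof.
split; first by exists [::]; rewrite ?big_nil.
  move=> p q [s sG ->] [t tG ->]; exists (s ++ t); last by rewrite big_cat.
  by move=> u; rewrite mem_cat => /orP[/sG | /tG].
move=> a p [s sG ->]; exists [seq (a * u.1, u.2) | u <- s].
  by move=> _ /mapP[u us ->]; apply: (sG u us).
by rewrite big_map mulr_sumr; apply: eq_bigr => u _; rewrite mulrA.
Qed.

Lemma ideal_gen_min G I : is_ideal I -> (forall p, G p -> I p) ->
  forall p, ideal_gen G p -> I p.
Proof.
move=> idI GI p [s sG ->]; rewrite big_seq.
by apply: ideal_sum => // u /sG/GI; case: idI => _ _; apply.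
Qed.

Lemma mem_ideal_gen G p : G p -> ideal_gen G p.
Proof.
by move=> Gp; exists [:: (1, p)] => [u|]; rewrite ?big_seq1 ?mul1r // inE => /eqP->.
Qed.

Lemma ideal_add_ideal I theta : is_ideal (ideal_add I theta).
Proof. exact: ideal_gen_ideal. Qed.

Lemma ideal_add_sub I theta p : I p -> ideal_add I theta p.
Proof. by move=> Ip; apply: mem_ideal_gen; left. Qed.

Lemma mem_ideal_add I theta p : p \in theta -> ideal_add I theta p.
Proof. by move=> pt; apply: mem_ideal_gen; right. Qed.

Lemma ideal_add_nil I p : is_ideal I -> ideal_add I [::] p -> I p.
Proof.
by move=> idI; apply: (@ideal_gen_min _ I) => // q [].
Qed.

Lemma ideal_add_rconsP I theta f p :
  ideal_add I (rcons theta f) p <-> exists g, ideal_add I theta (p - g * f).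
Proof.
have idT := ideal_add_ideal I theta; have idTf := ideal_add_ideal I (rcons theta f).
split; last first.
  case=> g Jg; rewrite -(subrK (g * f) p); case: (idTf) => _ ID IM; apply: ID.
    apply: ideal_gen_min Jg => // q [|qt]; first exact: ideal_add_sub.
    by apply: mem_ideal_add; rewrite mem_rcons inE qt orbT.
  by apply/IM/mem_ideal_add; rewrite mem_rcons mem_head.
apply: (@ideal_gen_min _ (fun u => exists g, ideal_add I theta (u - g * f)))
  => [|q [Iq|]].
- case: (idT) => I0 ID IM; split.
  + by exists 0; rewrite mul0r subr0.
  + move=> u v [a Ja] [b Jb]; exists (a + b).
    by rewrite mulrDl opprD addrACA; apply: ID.
  + move=> a u [b Jb]; exists (a * b); rewrite -mulrA -mulrBr; exact: IM.
- by exists 0; rewrite mul0r subr0; apply: ideal_add_sub.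
rewrite mem_rcons inE => /orP[/eqP-> | qt].
  by exists 1; rewrite mul1r subrr; case: idT.
by exists 0; rewrite mul0r subr0; apply: mem_ideal_add.
Qed.

(** ** Graded ideals *)

Local Notation comp d p := (pihomog mdeg d p).

Definition graded I : Prop := forall d p, I p -> I (comp d p).

Lemma pihomogM_homog d e p f : f \is e.-homog ->
  comp d (p * f) = if (e <= d)%N then comp (d - e) p * f else 0.
Proof.
move=> homf; pose k := maxn (msize p) d.+1.
rewrite {1}(pihomog_partitionE (leq_maxl (msize p) d.+1)) mulr_suml linear_sum /=.
have homM (i : 'I_k) : comp i p * f \is (i + e).-homog.
  by apply: dhomogM => //; apply: pihomogP.
case: leqP => [led | ltd]; last first.
  apply: big1 => i _; apply: pihomog_ne0 (homM i).
  by rewrite neq_ltn orbC (leq_trans ltd) ?leq_addl.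
have ltdk : (d - e < k)%N by rewrite /k leq_max ltnS leq_subr orbT.
rewrite (bigD1 (Ordinal ltdk)) //= big1 ?addr0 => [|i ne].
  by have := homM (Ordinal ltdk); rewrite /= subnK // => /pihomog_dE.
apply: pihomog_ne0 (homM i); apply: contraNneq ne => /(canRL (addnK _)) id.
by apply/eqP/val_inj.
Qed.

Lemma ideal_gen_graded G :
  (forall d g, G g -> ideal_gen G (comp d g)) -> graded (ideal_gen G).
Proof.
move=> gradG d p [s sG ->]; have idG := ideal_gen_ideal G.
rewrite linear_sum big_seq; apply: ideal_sum => // u /sG/gradG Gu /=.
rewrite (pihomog_partitionE (leqnn (msize u.2))) mulr_sumr linear_sum.
apply: ideal_sum => // i _ /=; case: (idG) => I0 _ IM.
rewrite (pihomogM_homog _ _ (pihomogP _ _ _)).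
by case: leqP => // _; apply/IM/Gu.
Qed.

Lemma ideal_gen_homog_graded G :
  (forall g, G g -> exists d, g \is d.-homog) -> graded (ideal_gen G).
Proof.
move=> homG; apply: ideal_gen_graded => d g Gg; have [e home] := homG _ Gg.
have [<- | ne] := eqVneq e d; first by rewrite pihomog_dE //; apply: mem_ideal_gen.
by rewrite (pihomog_ne0 ne home); case: (ideal_gen_ideal G).
Qed.

Lemma ideal_add_graded I theta : graded I ->
  (forall f, f \in theta -> exists d, f \is d.-homog) -> graded (ideal_add I theta).
Proof.
move=> gradI homt; apply: ideal_gen_graded => d g [Ig | gt].
  by apply/mem_ideal_gen; left; apply: gradI.
have [e home] := homt _ gt.
have [<- | ne] := eqVneq e d; first by rewrite pihomog_dE //; apply: mem_ideal_gen; right.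
by rewrite (pihomog_ne0 ne home); case: (ideal_add_ideal I theta).
Qed.

Lemma homog_subspace d : subspace (fun p => p \is d.-homog).
Proof.
split=> [|p q hp hq|c p hp]; first exact: dhomog0.
  exact: dhomogD.
exact: dhomogZ.
Qed.

End Ideals.

(** * The Hilbert function of a Stanley-Reisner ring *)

Section StanleyReisner.
Variables (K : fieldType) (X : finType).
Local Notation n := #|X|.
Local Notation P := {mpoly K[n]}.
Implicit Types (Gamma : {set {set X}}) (A F : {set X}) (m : 'X_{1..n}).

Definition msupport m : {set X} := [set x | m (enum_rank x) != 0%N].

Definition sqfree_mnm A : 'X_{1..n} := (\sum_(x in A) U_(enum_rank x))%MM.

Lemma sqfree_mnmE A x : sqfree_mnm A (enum_rank x) = (x \in A).
Proof.
rewrite mnm_sumE; under eq_bigr do rewrite mnm1E (inj_eq enum_rank_inj).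
have [xA | xA] := boolP (x \in A).
  by rewrite (bigD1 x) //= eqxx big1 // => y /andP[_ /negPf->].
by apply: big1 => y yA; case: eqVneq yA xA => // -> ->.
Qed.

Lemma sqfree_monomialE A : sqfree_monomial K A = 'X_[sqfree_mnm A].
Proof. by rewrite /sqfree_monomial mprodXE. Qed.

Definition down_closed Gamma : Prop :=
  forall F A, F \in Gamma -> A \subset F -> A \in Gamma.

(** The ideal is spanned by monomials: those whose support is not a face. *)
Lemma sr_idealP Gamma (p : P) : down_closed Gamma ->
  sr_ideal K Gamma p <-> forall m, m \in msupp p -> msupport m \notin Gamma.
Proof.
move=> downG; split.
  move=> [s sG ->] m; rewrite mcoeff_msupp => mp.
  have [u us] : exists2 u, u \in s & (u.1 * u.2)@_m != 0.
    apply: NNPP => nou; case/negP: mp; rewrite linear_sum big_seq big1 // => u us.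
    by apply/eqP/negPn/negP => nz; apply: nou; exists u.
  have [A AG ->] := sG u us.
  rewrite sqfree_monomialE -mcoeff_msupp => /msuppM_le/allpairsP[[m1 m2] /= [_ + ->]].
  rewrite msuppX inE => /eqP->; apply: contra AG => /downG; apply.
  by apply/subsetP => x xA; rewrite inE mnmDE sqfree_mnmE xA addn1.
move=> mG; have idI : is_ideal (sr_ideal K Gamma) by apply: ideal_gen_ideal.
rewrite [p]mpolyE big_seq; apply: ideal_sum => // m /mG mA.
have le_mA : (sqfree_mnm (msupport m) <= m)%MM.
  apply/mnm_lepP => i; rewrite -(enum_valK i) sqfree_mnmE inE.
  by case: (m _).
rewrite -(submK le_mA) mpolyXD scalerAl; case: idI => _ _; apply.
by apply: mem_ideal_gen; exists (msupport m); rewrite ?sqfree_monomialE.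
Qed.

Section Count.
Variables (Gamma : {set {set X}}) (M d : nat).

Definition fun_support (f : {ffun X -> 'I_M}) : {set X} := [set x | (f x : nat) != 0%N].

Definition degree_faces : {set {ffun X -> 'I_M}} :=
  [set f : {ffun X -> 'I_M} | (\sum_x f x == d)%N && (fun_support f \in Gamma)].

Definition fun_mnm (f : {ffun X -> 'I_M}) : 'X_{1..n} :=
  [multinom (f (enum_val i) : nat) | i < n].

Lemma fun_mnmE f x : fun_mnm f (enum_rank x) = f x.
Proof. by rewrite mnmE enum_rankK. Qed.

Lemma fun_mnm_inj : injective fun_mnm.
Proof.
by move=> f f' eqf; apply/ffunP => x; apply/val_inj; rewrite /= -!fun_mnmE eqf.
Qed.

Lemma msupport_fun_mnm f : msupport (fun_mnm f) = fun_support f.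
Proof. by apply/setP => x; rewrite !inE fun_mnmE. Qed.

Lemma mdeg_fun_mnm f : mdeg (fun_mnm f) = (\sum_x f x)%N.
Proof.
rewrite mdegE (reindex (@enum_rank X)) /=; last by apply: onW_bij; apply: enum_rank_bij.
by apply: eq_bigr => x _; rewrite fun_mnmE.
Qed.

Lemma fun_mnm_surj m : (mdeg m < M)%N -> exists f, fun_mnm f = m.
Proof.
move=> ltmM; have lem i : (m i < M)%N.
  by apply: leq_ltn_trans ltmM; rewrite mdegE (bigD1 i) ?leq_addr.
exists [ffun x => Ordinal (lem (enum_rank x))].
by apply/mnmP => i; rewrite mnmE ffunE /= enum_valK.
Qed.

Lemma quot_dim_sr_ideal : down_closed Gamma -> (d < M)%N ->
  quot_dim (fun p : P => p \is d.-homog) (sr_ideal K Gamma) #|degree_faces|.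
Proof.
move=> downG ltdM.
rewrite -[#|_|]card_sig; pose T := {f | f \in degree_faces}.
have sumE (a : T -> K) m :
    (\sum_t a t *: 'X_[fun_mnm (val t)])@_m = \sum_t a t * (fun_mnm (val t) == m)%:R.
  by rewrite linear_sum /=; apply: eq_bigr => t _; rewrite mcoeffZ mcoeffX.
have sumt (a : T -> K) t : \sum_u a u * (fun_mnm (val u) == fun_mnm (val t))%:R = a t.
  rewrite (bigD1 t) //= eqxx mulr1 big1 ?addr0 // => u ne.
  by rewrite (inj_eq fun_mnm_inj) (inj_eq val_inj) (negPf ne) mulr0.
apply: (quot_dim_basis (b := fun t : T => 'X_[fun_mnm (val t)])).
- move=> [f /= fG]; rewrite dhomogX /= mdeg_fun_mnm.
  by move: fG; rewrite inE => /andP[].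
- move=> p homp; exists (fun t => p@_(fun_mnm (val t))).
  apply/sr_idealP => // m; apply: contraL => mG.
  rewrite mcoeff_msupp negbK mcoeffB sumE.
  have [mdegm | nmdeg] := eqVneq (mdeg m) d.
    have [f fm] : exists f, fun_mnm f = m by apply: fun_mnm_surj; rewrite mdegm.
    have fG : f \in degree_faces.
      by rewrite inE -mdeg_fun_mnm -msupport_fun_mnm fm mdegm eqxx.
    by rewrite -fm (sumt _ (exist _ f fG)) subrr.
  rewrite (dhomog_nemf_coeff homp nmdeg) sub0r oppr_eq0 big1 // => t _.
  case: eqP => [tm | _]; last by rewrite mulr0.
  by rewrite tm (dhomog_nemf_coeff homp nmdeg) mul0r.
move=> a /sr_idealP Ja t; apply/eqP/negPn/negP => nz.
have := Ja downG (fun_mnm (val t)); rewrite mcoeff_msupp sumE sumt => /(_ nz).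
by rewrite msupport_fun_mnm; have := valP t; rewrite inE => /andP[_ ->].
Qed.

(** The power series t/(1 - t) up to degree M - 1. *)
Definition truncated_geom : {poly int} := \sum_(1 <= i < M) 'X^i.

(** The Hilbert series of the face ring, the sum over the faces F of
    (t/(1 - t))^|F|, correct below degree M. *)
Definition face_series : {poly int} := \sum_(F in Gamma) truncated_geom ^+ #|F|.

Lemma face_series_coef : (d < M)%N -> face_series`_d = #|degree_faces|%:Z.
Proof.
move=> ltdM; rewrite /face_series.
(* Choosing an exponent for each vertex: the exponents of the vertices of F
   range over 1, ..., M - 1, those of the other vertices are 0. *)
have expand F : truncated_geom ^+ #|F|
    = \sum_(f : {ffun X -> 'I_M}) (if fun_support f == F then 'X^(\sum_x f x) else 0).
  rewrite -prodr_const big_mkcond /=.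
  rewrite (eq_bigr (fun x => \sum_(i < M) if (x \in F) == (i != 0%N :> nat) then 'X^i else 0));
    last first.
    move=> x _; rewrite /truncated_geom; case: M ltdM => // M' _.
    rewrite big_ord_recl big_add1 /= big_mkord.
    case: (x \in F) => /=; first by rewrite add0r.
    by rewrite big1 ?addr0 // expr0.
  rewrite bigA_distr_bigA /=; apply: eq_bigr => f _.
  have [<- | neF] := eqVneq (fun_support f) F.
    by rewrite expr_sum; apply: eq_bigr => x _; rewrite inE eqxx.
  have [x xF] : exists x, (x \in F) != (f x != 0%N :> nat).
    apply/existsP; apply: contraNT neF; rewrite negb_exists => /forallP eqF.
    by apply/eqP/setP => x; rewrite inE; have := eqF x; rewrite negbK => /eqP.
  by rewrite (bigD1 x) //= (negPf xF) mul0r.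
under eq_bigr do rewrite expand.
have -> : #|degree_faces|%:Z = \sum_f (f \in degree_faces)%:R.
  rewrite -natz -sum1_card natr_sum big_mkcond /=.
  by apply: eq_bigr => f _; case: ifP.
rewrite exchange_big coef_sum /=.
apply: eq_bigr => f _; rewrite coef_sum inE.
have [fG | fG] := boolP (fun_support f \in Gamma); last first.
  rewrite andbF big1 // => F FG; case: eqP => [fF | _]; last by rewrite coef0.
  by rewrite fF FG in fG.
rewrite (bigD1 (fun_support f)) //= eqxx coefXn [X in _ + X]big1 => [|F /andP[_ ne]].
  by rewrite addr0 andbT eq_sym; case: eqP.
by rewrite eq_sym (negPf ne) coef0.
Qed.

End Count.

End StanleyReisner.

(** * Regular sequences and the top degree of an artinian reduction *)

Section HilbertQuotient.
Variables (K : fieldType) (n : nat).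
Local Notation P := {mpoly K[n]}.
Implicit Types (I J V W : P -> Prop) (theta : seq P) (p f g : P).

Local Notation "'forms' d" := (fun p : P => p \is d.-homog) (at level 10, d at level 8).

(** Quotients of one subspace [V] by the traces of different ideals are compared
    inside a common space [V']. *)
Lemma quot_dim_cap V V' J s : subspace V -> (forall p, V p -> V' p) ->
  quot_dim V (fun p => V' p /\ J p) s <-> quot_dim V J s.
Proof.
move=> sV VV'; have sumV (b : 'I_s -> P) (a : 'I_s -> K) :
    (forall i, V (b i)) -> V (\sum_i a i *: b i).
  by move=> Vb; apply: subspace_sum => // i _; case: sV => _ _; apply.
split=> [] [b [Vb spanb freeb]]; exists b; split=> //.
- by move=> p /spanb[a [_ Ja]]; exists a.
- by move=> a Ja; apply: freeb; split=> //; apply/VV'/sumV.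
- move=> p Vp; have [a Ja] := spanb p Vp; exists a; split=> //.
  by apply: VV'; apply: (subspaceB sV Vp); apply: sumV.
- by move=> a [_ Ja]; apply: freeb.
Qed.

Lemma quot_dim0 V J : (forall p, V p -> J p) -> quot_dim V J 0.
Proof.
move=> VJ; exists (fun _ => 0); split=> [[]|p /VJ Jp|a _ []] //.
by exists (fun _ => 0); rewrite big_ord0 subr0.
Qed.

Lemma quot_dim0_sub V J p : quot_dim V J 0 -> V p -> J p.
Proof. by case=> b [_ spanb _] /spanb[a]; rewrite big_ord0 subr0. Qed.

(** [q] agrees below degree [M] with the Hilbert series of P/J; truncating lets
    polynomials replace power series. *)
Definition hilbert_upto (M : nat) (q : {poly int}) J : Prop :=
  forall d, (d < M)%N -> exists2 H : nat, q`_d = H%:Z & quot_dim (forms d) J H.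

(** In degree d, multiplication by [f] embeds the forms of degree d - e modulo [I]
    into those of degree d, and the quotient is the piece of degree d of P/J, where
    J = I + (f). *)
Lemma hilbert_upto_regular M q I J f e :
  is_ideal I -> graded I -> f \is e.-homog -> (forall g, I (f * g) -> I g) ->
  is_ideal J -> (forall p, J p <-> exists g, I (p - g * f)) ->
  hilbert_upto M q I -> hilbert_upto M (q * (1 - 'X^e)) J.
Proof.
move=> idI gradI homf regf idJ JE hilbI d ltdM.
have [H qH dimI] := hilbI d ltdM.
have sI := ideal_subspace idI; have sJ := ideal_subspace idJ.
have sV := @homog_subspace K n d.
have IJ p : I p -> J p by move=> Ip; apply/JE; exists 0; rewrite mul0r subr0.
have [s dimJ] : exists s, quot_dim (forms d) J s.
  apply: (quot_dim_exists (t := H)) => // s b Vb freeb; rewrite -[s]card_ord.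
  by apply: (quot_dim_free_leq sI dimI Vb) => a /IJ/freeb.
pose W p := p \is d.-homog /\ J p; pose I' p := p \is d.-homog /\ I p.
have sI' : subspace I'.
  case: sV sI => [V0 VD VZ] [I0 ID IZ]; split=> //.
    by move=> p r [? ?] [? ?]; split; [apply: VD | apply: ID].
  by move=> c p [? ?]; split; [apply: VZ | apply: IZ].
have sW : subspace W.
  case: sV sJ => [V0 VD VZ] [J0 JD JZ]; split=> //.
    by move=> p r [? ?] [? ?]; split; [apply: VD | apply: JD].
  by move=> c p [? ?]; split; [apply: VZ | apply: JZ].
have WE p : p \is d.-homog -> J p ->
    exists g, I (p - (if (e <= d)%N then pihomog mdeg (d - e) g * f else 0)).
  move=> homp /JE[g /(gradI d)]; rewrite pihomogB (pihomogM_homog _ _ homf).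
  by rewrite (pihomog_dE homp) => ?; exists g.
have [H' qH' dimW] : exists2 H' : nat,
    (if (d < e)%N then 0 else q`_(d - e)) = H'%:Z & quot_dim W I H'.
  case: ltnP WE => [lt_de | le_ed] WE.
    exists 0%N => //; apply: quot_dim0 => p [homp /(WE _ homp)[g]].
    by rewrite subr0.
  have [H' qH' dimH'] := hilbI (d - e)%N (leq_ltn_trans (leq_subr _ _) ltdM).
  exists H' => //; apply: (quot_dim_mull (f := f) sI) dimH'.
  - move=> p homp; split; first by rewrite -(subnK le_ed); apply: dhomogM.
    by apply/JE; exists p; rewrite subrr; case: sI.
  - move=> p [homp /(WE _ homp)[g Ig]]; exists (pihomog mdeg (d - e) g) => //.
    exact: pihomogP.
  - move=> g; split=> [|Ig]; first by rewrite mulrC => /regf.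
    by rewrite mulrC; case: idI => _ _; apply.
exists s => //; rewrite mulrBr mulr1 coefB coefMXn qH qH'.
suff -> : H = (s + H')%N by rewrite PoszD addrK.
have dimI' : quot_dim (forms d) I' H.
  exact/(quot_dim_cap _ _ sV (fun _ hp => hp)).
have dimW' : quot_dim (forms d) W s.
  exact/(quot_dim_cap _ _ sV (fun _ hp => hp)).
apply: (quot_dim_uniq sI' dimI'); apply: (quot_dim_trans sI' sW) dimW' _.
- by move=> p [? /IJ].
- by move=> p [].
by apply/(quot_dim_cap _ _ sW _) => // p [].
Qed.

(** The factor [c] is the product of the 1 - t^e over the degrees e of the
    sequence. *)
Lemma regular_hilbert_factor I theta : is_ideal I -> graded I ->
  (forall f, f \in theta -> exists2 d, (0 < d)%N & f \is d.-homog) ->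
  (forall i, (i < size theta)%N -> forall g,
    ideal_add I (take i theta) (nth 0 theta i * g) -> ideal_add I (take i theta) g) ->
  exists2 c : {poly int}, `|lead_coef c| = 1 &
    forall M q, hilbert_upto M q I -> hilbert_upto M (q * c) (ideal_add I theta).
Proof.
move=> idI gradI homt regt.
suff: forall i, (i <= size theta)%N -> exists2 c : {poly int}, `|lead_coef c| = 1 &
    forall M q, hilbert_upto M q I ->
      hilbert_upto M (q * c) (ideal_add I (take i theta)).
  by move/(_ _ (leqnn _)); rewrite take_size.
elim=> [_|i IH ltit].
  exists 1 => [|M q hilbI d /hilbI[H qH dimI]]; first by rewrite lead_coef1 normr1.
  exists H; rewrite ?mulr1 // take0; case: dimI => b [homb spanb freeb].
  exists b; split=> // [p /spanb[a Ia] | a /(ideal_add_nil idI)/freeb //].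
  by exists a; apply: ideal_add_sub.
have [c lc1 hilbc] := IH (ltnW ltit).
have [e e_gt0 home] := homt _ (mem_nth 0 ltit).
exists (c * (1 - 'X^e)).
  rewrite lead_coefM normrM lc1 mul1r -[1 - _]opprB lead_coefN normrN.
  rewrite lead_coefDl ?lead_coefXn ?normr1 //.
  by rewrite size_polyN size_poly1 size_polyXn ltnS.
move=> M q /hilbc; rewrite mulrA; apply: hilbert_upto_regular home _ _ _.
- exact: ideal_add_ideal.
- apply: ideal_add_graded => // f /mem_take/homt[d _ homf]; by exists d.
- exact: regt.
- exact: ideal_add_ideal.
by move=> p; rewrite (take_nth 0 ltit); apply: ideal_add_rconsP.
Qed.

(** A form of degree d + 1 is a combination of variables times forms of degree d.
    So once [J] contains all forms of some degree it contains those of every larger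
    degree, and the variables carry the last degree not contained in [J] into [J]. *)
Lemma artinian_top_degree J t : is_ideal J -> graded J -> ~ J 1 ->
  quot_dim (fun _ => True) J t ->
  exists d, [/\ ~ (forall p, p \is d.-homog -> J p),
    forall e p, (d < e)%N -> p \is e.-homog -> J p
    & forall p, p \is d.-homog -> socle J p].
Proof.
move=> idJ gradJ nJ1 dimJ; have sJ := ideal_subspace idJ.
pose full d := forall p, p \is d.-homog -> J p.
have fullS d : full d -> full d.+1.
  move=> fd p /dhomogP homp; rewrite [p]mpolyE big_seq.
  apply: ideal_sum => // m /homp /= degm.
  have [i mi] : exists i, m i != 0%N.
    apply/existsP; apply: contraTT isT; rewrite negb_exists => /forallP m0.
    suff m00 : m = 0%MM by move: degm; rewrite m00 mdeg0.
    by apply/mnmP => i; rewrite mnm0E; apply/eqP; have := m0 i; rewrite negbK.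
  have le1 : (U_(i) <= m)%MM by rewrite lep1mP.
  case: (sJ) => _ _; apply; rewrite -(submK le1) mpolyXD mulrC.
  case: (idJ) => _ _; apply; apply: fd; rewrite dhomogX /=.
  by have := mdegD (m - U_(i)) U_(i); rewrite submK // degm mdeg1 addn1 => - [<-].
have full_leq d e : (d <= e)%N -> full d -> full e.
  move=> /subnK<- fd; elim: (e - d)%N => // k; rewrite addSn; exact: fullS.
have [m fm] : exists m, full m.
  apply: NNPP => nofull.
  (* Forms of distinct degrees outside a graded ideal are independent modulo it,
     and P/J has dimension t. *)
  have pick (d : 'I_t.+1) : exists p, p \is d.-homog /\ ~ J p.
    apply: NNPP => nop; apply: nofull; exists (d : nat) => p homp.
    by apply: NNPP => nJp; apply: nop; exists p.
  have [b bP] := fin_all_exists pick.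
  suff : (#|'I_t.+1| <= t)%N by rewrite card_ord ltnn.
  apply: (quot_dim_free_leq sJ dimJ (b := b)) => // a Ja i.
  apply/eqP/negPn/negP => nz; case: (bP i) => homb; apply.
  have := gradJ i _ Ja; rewrite linear_sum (bigD1 i) //= linearZ /=.
  rewrite (pihomog_dE homb) big1 ?addr0 => [Jai | j ne].
    rewrite -(scale1r (b i)) -(mulVf nz) -scalerA.
    by case: (sJ) => _ _; apply.
  rewrite linearZ /= (pihomog_ne0 _ (bP j).1) ?scaler0 //.
have [d [fd nfd]] : exists d, full d.+1 /\ ~ full d.
  elim: m fm => [f0 | m IH fm]; first by case: nJ1; apply/f0/dhomog1.
  by have [/IH | nf] := classic (full m); last by exists m.
exists d; split=> // [e p lt_de | p homp i]; first exact: full_leq lt_de fd p.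
by apply: fd; rewrite -add1n; apply: dhomogM => //; rewrite dhomogX /= mdeg1.
Qed.

End HilbertQuotient.

(** * The type of a Cohen-Macaulay Stanley-Reisner ring *)

Definition eq_trunc (M : nat) (p q : {poly int}) : Prop :=
  forall i, (i < M)%N -> p`_i = q`_i.

Lemma eq_truncM M (p p' q q' : {poly int}) :
  eq_trunc M p p' -> eq_trunc M q q' -> eq_trunc M (p * q) (p' * q').
Proof.
move=> ep eq i ltiM; rewrite !coefM; apply: eq_bigr => j _.
by rewrite ep ?eq // (leq_ltn_trans _ ltiM) // ?leq_subr // -ltnS.
Qed.

Lemma eq_truncX M (p q : {poly int}) k : eq_trunc M p q -> eq_trunc M (p ^+ k) (q ^+ k).
Proof.
by move=> epq; elim: k => [|k IH]; rewrite ?expr0 // !exprS; apply: eq_truncM.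
Qed.

Lemma eq_trunc_sum M (I : Type) (r : seq I) (A : pred I) (F G : I -> {poly int}) :
  (forall i, A i -> eq_trunc M (F i) (G i)) ->
  eq_trunc M (\sum_(i <- r | A i) F i) (\sum_(i <- r | A i) G i).
Proof. by move=> eFG i ltiM; rewrite !coef_sum; apply: eq_bigr => j /eFG->. Qed.

Lemma eq_trunc_eq M (p q : {poly int}) :
  (size p <= M)%N -> (size q <= M)%N -> eq_trunc M p q -> p = q.
Proof.
move=> sp sq epq; apply/polyP => i; have [/epq // | leMi] := ltnP i M.
by rewrite !nth_default // (leq_trans _ leMi).
Qed.

Lemma truncated_geomE M : eq_trunc M ((1 - 'X) * truncated_geom M) 'X.
Proof.
case: M => [|M] i // ltiM; rewrite /truncated_geom.
have -> : (1 - 'X) * (\sum_(1 <= j < M.+1) 'X^j) = 'X - 'X^(M.+1) :> {poly int}.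
  rewrite mulr_sumr (eq_bigr (fun j => - ('X^(j.+1) - 'X^j))) => [|j _].
    by rewrite sumrN telescope_sumr // expr1 opprB.
  by rewrite mulrBl mul1r -exprS opprB.
by rewrite coefB coefXn (ltn_eqF ltiM) subr0.
Qed.

Section TypeBound.
Variables (K : fieldType) (X : finType) (Gamma : {set {set X}}) (d : nat).
Hypothesis downG : down_closed Gamma.
Hypothesis dimG : forall F, F \in Gamma -> (#|F| <= d)%N.

(** The numerator of the Hilbert series over the denominator (1 - t)^d. *)
Definition h_poly : {poly int} := \sum_(F in Gamma) 'X^#|F| * (1 - 'X) ^+ (d - #|F|).

(** The coefficient of t^d in [h_poly]. *)
Definition top_h : int := \sum_(F in Gamma) (-1) ^+ (d - #|F|).

Lemma h_poly_term_size F : F \in Gamma ->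
  size ('X^#|F| * (1 - 'X) ^+ (d - #|F|) : {poly int}) = d.+1.
Proof.
move=> FG; have X1 : (1 - 'X : {poly int}) != 0.
  by rewrite -size_poly_eq0 -size_polyN opprB size_XsubC.
rewrite mulrC size_mulXn ?expf_neq0 // -[1 - 'X]opprB exprNn.
by rewrite size_Msign -polyC1 size_exp_XsubC addnS subnKC ?dimG.
Qed.

Lemma size_h_poly : (size h_poly <= d.+1)%N.
Proof.
apply: (leq_trans (size_sum _ _ _)); apply/bigmax_leqP => F FG.
by rewrite h_poly_term_size.
Qed.

Lemma h_poly_coef : h_poly`_d = top_h.
Proof.
rewrite coef_sum; apply: eq_bigr => F FG.
have := h_poly_term_size FG => sz; rewrite -[d in LHS]/(d.+1.-1) -{2}sz -lead_coefE.
rewrite lead_coefM lead_coefXn mul1r lead_coef_exp -[1 - _]opprB lead_coefN.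
by rewrite -polyC1 lead_coefXsubC.
Qed.

Lemma face_series_h M :
  eq_trunc M ((1 - 'X) ^+ d * face_series Gamma M) h_poly.
Proof.
rewrite /face_series mulr_sumr; apply: eq_trunc_sum => F FG.
(* (1 - t)^d g^|F| = (1 - t)^(d - |F|) ((1 - t) g)^|F| *)
rewrite -{1}(subnKC (dimG FG)) exprD mulrAC -exprMn.
by apply: eq_truncM => //; apply/eq_truncX/truncated_geomE.
Qed.

(** Let r be the Hilbert series, a polynomial, of an artinian reduction B by a
    homogeneous regular sequence of degrees e_i. Then (1 - t)^d r = h (1 - t^e_1) ... (1 - t^e_l)
    as polynomials, so that the leading coefficients of r and of h agree up to sign.
    The leading coefficient of r is the dimension of the last nonzero degree of B,
    and this degree lies in the socle. *)
Theorem cm_type_bound t : top_h != 0 ->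
  cm_of_type (sr_ideal K Gamma) t -> `|top_h| <= t%:Z.
Proof.
move=> nz [theta [[homt _ [t0 finB]] [nJ1 regt] socB]].
pose I := sr_ideal K Gamma; pose J := ideal_add I theta.
have idI : is_ideal I by apply: ideal_gen_ideal.
have gradI : graded I.
  apply: ideal_gen_homog_graded => _ [A _ ->]; exists #|A|.
  rewrite sqfree_monomialE dhomogX /= mdeg_sum.
  by under eq_bigr do rewrite mdeg1; rewrite sum1_card.
have idJ : is_ideal J by apply: ideal_add_ideal.
have gradJ : graded J.
  by apply: ideal_add_graded => // f /homt[e _ home]; exists e.
have sJ := ideal_subspace idJ.
have [c lc1 hilbc] := regular_hilbert_factor idI gradI homt regt.
have [e [ne fe soce]] := artinian_top_degree idJ gradJ nJ1 finB.
(* Both sides of the identity between polynomials have size at most M. *)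
pose M := (e.+1 + d + size (h_poly * c)%R)%N.
have hilbI : hilbert_upto M (face_series Gamma M) I.
  move=> i ltiM; exists #|degree_faces Gamma M i|; first exact: face_series_coef.
  exact: quot_dim_sr_ideal.
have hilbJ := hilbc _ _ hilbI; pose r := \poly_(i < e.+1) (face_series Gamma M * c)`_i.
have lteM : (e < M)%N by rewrite /M -addnA leq_addr.
have [H rH dimH] := hilbJ e lteM.
have H0 : H != 0%N.
  by apply/eqP => H0; apply: ne => p homp; rewrite H0 in dimH; apply: quot_dim0_sub dimH homp.
have rE : eq_trunc M r (face_series Gamma M * c).
  move=> i ltiM; rewrite coef_poly; case: ltnP => // lt_ei.
  have [Hi -> dimi] := hilbJ i ltiM.
  by rewrite (quot_dim_uniq sJ dimi (quot_dim0 (fun p => fe i p lt_ei))).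
have lr : lead_coef r = H%:Z.
  by rewrite lead_coef_poly // rH; rewrite -lt0n in H0; rewrite eqz_nat gtn_eqF.
have identity : (1 - 'X) ^+ d * r = h_poly * c.
  apply: (eq_trunc_eq (M := M)); last 1 first.
  - have := eq_truncM (@face_series_h M) (fun i _ => erefl c`_i).
    move=> E i ltiM; rewrite -E // -mulrA; apply: eq_truncM rE i ltiM => //.
  - apply: (leq_trans (size_polyMleq _ _)).
    apply: (@leq_trans (d.+1 + e.+1).-1); last by rewrite addSn /M addnC leq_addr.
    rewrite -!subn1 leq_sub2r // leq_add ?size_poly //.
    apply: (leq_trans (size_poly_exp_leq _ _)).
    by rewrite -size_polyN opprB size_XsubC mul1n.
  - by rewrite /M leq_addl.
have lead1 : `|lead_coef (1 - 'X : {poly int})| = 1.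
  by rewrite -[1 - _]opprB lead_coefN normrN -polyC1 lead_coefXsubC normr1.
have lh : lead_coef h_poly = top_h.
  have sz : size h_poly = d.+1.
    apply/eqP; rewrite eqn_leq size_h_poly ltnNge; apply: contra nz => le.
    by rewrite -h_poly_coef nth_default.
  by rewrite lead_coefE sz h_poly_coef.
have := congr1 (fun p => `|lead_coef p|) identity.
rewrite !lead_coefM !normrM lead_coef_exp normrX lead1 expr1n mul1r lc1 mulr1 lr lh => <-.
rewrite lez_nat; apply: (quot_dim_leq sJ _ dimH socB); exact: soce.
Qed.

End TypeBound.

(** * Substitutions and products of variables *)

Section Substitution.
Variables (K : fieldType) (n : nat).
Local Notation P := {mpoly K[n]}.
Implicit Types (p g h : P) (J Q : P -> Prop).

Local Notation subst s := (mmap (@mpolyC n K) s).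

Lemma mmapXU (S : comNzRingType) (f : {rmorphism K -> S}) (s : 'I_n -> S) i :
  mmap f s 'X_i = s i.
Proof. by rewrite mmapX mmap1U. Qed.

(** An endomorphism that fixes each variable modulo an ideal fixes every
    polynomial modulo that ideal. *)
Lemma subst_congr J (f : {rmorphism P -> P}) : is_ideal J ->
  (forall c, f c%:MP = c%:MP) -> (forall i, J ('X_i - f 'X_i)) ->
  forall p, J (p - f p).
Proof.
move=> idJ fC fX p; have sJ := ideal_subspace idJ; case: (idJ) => J0 _ JM.
have congM u v : J (u - f u) -> J (v - f v) -> J (u * v - f (u * v)).
  move=> Ju Jv; rewrite rmorphM -[u * v](subrK (f u * v)) -addrA -mulrBl -mulrBr.
  by case: idJ => _ ID _; apply: ID; [rewrite mulrC|]; apply: JM.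
have cong1 : J (1 - f 1) by rewrite rmorph1 subrr.
have -> : p - f p = \sum_(m <- msupp p) (p@_m)%:MP * ('X_[m] - f 'X_[m]).
  rewrite {1 2}[p]mpolyE rmorph_sum -sumrB; apply: eq_bigr => m _.
  by rewrite -mul_mpolyC rmorphM /= fC mulrBr.
apply: ideal_sum => // m _; apply: JM; rewrite mpolyXE_id.
elim/big_ind: _ => // i _; elim: (m i) => [|k IH]; first by rewrite expr0.
by rewrite exprS; apply: congM.
Qed.

Lemma rmorph_ker_prime (S : idomainType) (f : {rmorphism P -> S}) :
  prime_ideal (fun p => f p = 0).
Proof.
split; first split.
- exact: rmorph0.
- by move=> p q fp fq; rewrite rmorphD fp fq addr0.
- by move=> a p fp; rewrite rmorphM fp mulr0.
- by move/eqP; rewrite rmorph1 oner_eq0.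
by move=> p q /eqP; rewrite rmorphM mulf_eq0 => /orP[]/eqP; [left | right].
Qed.

Lemma preim_principal_ideal (S : comNzRingType) (f : {rmorphism P -> S}) (u : S) :
  is_ideal (fun p => exists v, f p = u * v).
Proof.
split; first by exists 0; rewrite rmorph0 mulr0.
  by move=> p q [v fp] [w fq]; exists (v + w); rewrite rmorphD mulrDr fp fq.
by move=> a p [v fp]; exists (f a * v); rewrite rmorphM fp mulrCA.
Qed.

Definition kill (D : pred 'I_n) : P -> P := subst (fun i => if D i then 0 else 'X_i).

HB.instance Definition _ D := GRing.RMorphism.on (kill D).

Lemma killX D i : kill D 'X_i = if D i then 0 else 'X_i.
Proof. exact: mmapXU. Qed.

Lemma killC D c : kill D c%:MP = c%:MP.
Proof. exact: mmapC. Qed.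

Lemma kill_congr (D : pred 'I_n) J : is_ideal J -> (forall i, D i -> J 'X_i) ->
  forall p, J (p - kill D p).
Proof.
move=> idJ JD; apply: (@subst_congr _ (kill D)) => // [c | i]; first exact: killC.
by rewrite /= killX; case: ifP => [/JD | _]; rewrite ?subr0 // subrr; case: idJ.
Qed.

Lemma dvd_var i p : kill (pred1 i) p = 0 -> exists g, p = 'X_i * g.
Proof.
move=> kp; have [] := @kill_congr (pred1 i) (fun q => exists g, q = 'X_i * g) _ _ p.
- exact: (preim_principal_ideal idfun).
- by move=> _ /eqP->; exists 1; rewrite mulr1.
by move=> g; rewrite kp subr0; exists g.
Qed.

(** The variables are primes, so a product of variables none of which divides
    [h] can be cancelled against [h]. *)
Lemma prod_var_gauss (s : seq 'I_n) h g q :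
  (forall i, i \in s -> kill (pred1 i) h != 0) ->
  h * g = \prod_(i <- s) 'X_i * q -> exists g', g = \prod_(i <- s) 'X_i * g'.
Proof.
elim: s g q => [|i s IH] g q hs; first by exists g; rewrite big_nil mul1r.
rewrite !big_cons => hg.
have [|g1 g1E] := @dvd_var i g.
  apply/eqP; have := congr1 (kill (pred1 i)) hg.
  rewrite !rmorphM /= killX /= eqxx !mul0r => /eqP; rewrite mulf_eq0.
  by rewrite (negPf (hs i (mem_head _ _))).
have Xnz : 'X_i != 0 :> P by rewrite -msize_poly_eq0 msizeX.
have hs' j : j \in s -> kill (pred1 j) h != 0.
  by move=> js; apply: hs; rewrite inE js orbT.
have [|g' g1'] := IH g1 q hs'.
  by apply: (mulfI Xnz); rewrite mulrCA -g1E hg mulrA.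
by exists g'; rewrite g1E g1' mulrA.
Qed.

End Substitution.

(** * Krull dimension and growth *)

Section KrullBound.
Variables (K : fieldType) (n : nat).
Local Notation P := {mpoly K[n]}.
Implicit Types (p f g : P) (J Q : P -> Prop).

Definition has_free_family Q (m s : nat) : Prop :=
  exists2 b : 'I_s -> P, (forall i, (msize (b i) <= m.+1)%N) & free_mod Q b.

(** If b1 is independent modulo Q and b2 modulo Q', then f b1 together with b2 is
    independent modulo Q: a relation is first read modulo Q', which contains f, and
    then divided by f, which the prime Q does not contain. *)
Lemma has_free_family_step Q Q' f m1 m2 m s1 s2 : prime_ideal Q -> is_ideal Q' ->
  (forall p, Q p -> Q' p) -> Q' f -> ~ Q f ->
  has_free_family Q m1 s1 -> has_free_family Q' m2 s2 ->
  (m1 + (msize f).+1 <= m)%N -> (m2 <= m)%N -> has_free_family Q m (s1 + s2).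
Proof.
move=> [idQ _ primeQ] idQ' QQ' Q'f nQf [b1 sz1 free1] [b2 sz2 free2] le1 le2.
exists (cat_fam (fun i => b1 i * f) b2).
  move=> i; rewrite /cat_fam; case: (split i) => j; last exact: leq_trans (sz2 j) _.
  apply: (leq_trans (msizeM_le _ _)); rewrite ltnS; apply: leq_trans le1.
  by rewrite addnS -addSn leq_add2r.
move=> a; rewrite cat_fam_sum.
have -> : \sum_i a (lshift s2 i) *: (b1 i * f) = (\sum_i a (lshift s2 i) *: b1 i) * f.
  by rewrite mulr_suml; apply: eq_bigr => i _; rewrite scalerAl.
move=> Qa; have a2 : forall i, a (rshift s1 i) = 0.
  apply: free2; rewrite -[X in Q' X](addKr ((\sum_i a (lshift s2 i) *: b1 i) * f)).
  case: (idQ') => _ ID IM; apply: ID; last exact: QQ'.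
  by rewrite -mulNr; apply: IM.
apply: cat_fam0 (a2); apply: free1.
move: Qa; rewrite [X in _ + X]big1 ?addr0 => [/primeQ[] // | i _].
by rewrite a2 scale0r.
Qed.

Lemma has_free_family_iter Q Q' f m s j : prime_ideal Q -> is_ideal Q' ->
  (forall p, Q p -> Q' p) -> Q' f -> ~ Q f -> has_free_family Q' m s ->
  has_free_family Q (m + j * (msize f).+1) (j.+1 * s).
Proof.
move=> primeQ idQ' QQ' Q'f nQf free; elim: j => [|j IH].
  rewrite mul1n addn0; case: free => b szb freeb; exists b => //.
  by move=> a /QQ'/freeb.
rewrite [(j.+2 * s)%N]mulSnr.
apply: (has_free_family_step primeQ idQ' QQ' Q'f nQf IH free); last exact: leq_addr.
by rewrite -addnA -mulSnr.
Qed.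

(** For a strict chain of primes Q_0 < ... < Q_d and f_i in Q_i but not in
    Q_(i-1), the monomials in f_1, ..., f_d are linearly independent modulo Q_0. *)
Lemma chain_free_family (d : nat) (Q : nat -> P -> Prop) :
  (forall i, (i <= d)%N -> prime_ideal (Q i)) ->
  (forall i, (i < d)%N -> (forall p, Q i p -> Q i.+1 p) /\
     (exists2 p, Q i.+1 p & ~ Q i p)) ->
  exists E, forall j, has_free_family (Q 0%N) (j * E) (j.+1 ^ d).
Proof.
elim: d Q => [|d IH] Q primeQ chainQ.
  exists 0%N => j; rewrite expn0.
  exists (fun _ => 1) => [i|a]; first by rewrite msize1.
  rewrite big_ord1 => Qa i; rewrite ord1; apply/eqP/negPn/negP => nz.
  have [[_ _ QM] nQ1 _] := primeQ 0%N isT; apply: nQ1.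
  rewrite -[1](scalerK nz) -mul_mpolyC; exact: QM.
have [||E freeE] := IH (fun i => Q i.+1).
- by move=> i ltid; apply: primeQ.
- by move=> i ltid; apply: chainQ.
have [QQ' [f Q'f nQf]] := chainQ 0%N isT; exists (E + (msize f).+1)%N => j.
rewrite mulnDr expnS; apply: has_free_family_iter QQ' Q'f nQf (freeE j).
  exact: primeQ.
by case: (primeQ 1%N isT).
Qed.

Lemma spans_mod_subspace J (T : finType) (g : T -> P) :
  subspace J -> subspace (spans_mod J g).
Proof.
case=> J0 JD JZ; split.
- by exists (fun _ => 0); rewrite big1 ?subr0 // => t _; rewrite scale0r.
- move=> p q [a Ja] [b Jb]; exists (fun t => a t + b t).
  under eq_bigr do rewrite scalerDl.
  by rewrite big_split opprD addrACA; apply: JD.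
move=> c p [a Ja]; exists (fun t => c * a t).
under eq_bigr do rewrite -scalerA.
by rewrite -scaler_sumr -scalerBr; apply: JZ.
Qed.

(** Modulo Q, the polynomials of degree at most [m] are spanned by the monomials in
    the variables of [D] with exponents at most [m]. *)
Lemma free_family_leq Q (D : {set 'I_n}) m s : is_ideal Q ->
  (forall i, i \notin D -> Q 'X_i) -> has_free_family Q m s ->
  (s <= m.+1 ^ #|D|)%N.
Proof.
move=> idQ QD [b szb freeb]; have sQ := ideal_subspace idQ.
pose T := {h : {ffun 'I_n -> 'I_m.+1} | h \in pffun_on ord0 D predT}.
have -> : (m.+1 ^ #|D| = #|{: T}|)%N.
  by rewrite card_sig card_pffun_on card_ord.
pose g (t : T) : P := 'X_[ [multinom (val t i : nat) | i < n] ].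
rewrite -[s]card_ord; apply: (free_mod_leq_card (g := g) sQ freeb) => i.
rewrite [b i]mpolyE big_seq; apply: subspace_sum => [|u ubi].
  exact: spans_mod_subspace.
case: (spans_mod_subspace g sQ) => _ _; apply.
have [suD | nsuD] := boolP [forall j, (j \in D) || (u j == 0%N)]; last first.
  exists (fun _ => 0); rewrite big1 ?subr0 => [|t _]; last by rewrite scale0r.
  move: nsuD; rewrite negb_forall => /existsP[j]; rewrite negb_or => /andP[jD uj].
  have le1 : (U_(j) <= u)%MM by rewrite lep1mP.
  by rewrite -(submK le1) mpolyXD; case: idQ => _ _; apply; apply: QD.
have ltu j : (u j < m.+1)%N.
  apply: leq_ltn_trans (leq_trans (msize_mdeg_lt ubi) (szb i)).
  by rewrite mdegE (bigD1 j) ?leq_addr.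
pose h : {ffun 'I_n -> 'I_m.+1} := [ffun j => Ordinal (ltu j)].
have hD : h \in pffun_on ord0 D predT.
  apply/pffun_onP; split; last by move=> x _.
  apply/subsetP => j; rewrite inE ffunE; apply: contraNT => jD.
  by have := forallP suD j; rewrite (negPf jD).
exists (fun t => (t == exist _ h hD)%:R).
rewrite (bigD1 (exist _ h hD : T)) //= eqxx scale1r big1 ?addr0 => [|t /negPf->]; last first.
  by rewrite scale0r.
have -> : u = [multinom (h j : nat) | j < n] by apply/mnmP => j; rewrite mnmE ffunE.
by rewrite subrr; case: idQ.
Qed.

(** The family of [chain_free_family] has (j + 1)^d members of degree at most j E,
    but only (j E + 1)^|D| of them can be independent; let j grow. *)
Lemma prime_chain_leq (d : nat) (Q : nat -> P -> Prop) (D : {set 'I_n}) :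
  (forall i, (i <= d)%N -> prime_ideal (Q i)) ->
  (forall i, (i < d)%N -> (forall p, Q i p -> Q i.+1 p) /\
     (exists2 p, Q i.+1 p & ~ Q i p)) ->
  (forall i, i \notin D -> Q 0%N 'X_i) -> (d <= #|D|)%N.
Proof.
move=> primeQ chainQ QD; have [E freeE] := chain_free_family primeQ chainQ.
have idQ : is_ideal (Q 0%N) by case: (primeQ 0%N isT).
(* For j = (E + 1)^|D| one has (j E + 1)^|D| <= ((j + 1) (E + 1))^|D|
   = (j + 1)^|D| j, which is less than (j + 1)^d if |D| < d. *)
rewrite leqNgt; apply/negP => ltDd; pose c := (E.+1 ^ #|D|)%N.
have := free_family_leq idQ QD (freeE c); apply/negP; rewrite -ltnNge.
have le1 : ((c * E).+1 <= c.+1 * E.+1)%N by nia.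
have le2 : ((c * E).+1 ^ #|D| <= (c.+1 * E.+1) ^ #|D|)%N.
  by case: #|D| => // k; rewrite leq_exp2r.
apply: (leq_ltn_trans le2); rewrite expnMn -/c.
apply: (@leq_trans (c.+1 ^ #|D|.+1)); last by rewrite leq_pexp2l.
by rewrite expnSr ltn_pmul2l ?expn_gt0.
Qed.

End KrullBound.

(** * The boundary of a simplex *)

Section SimplexBoundary.
Variables (K : fieldType) (X : finType) (V : {set X}) (v0 : X).
Hypothesis v0V : v0 \in V.
Local Notation n := #|X|.
Local Notation P := {mpoly K[n]}.
Local Notation var x := ('X_(enum_rank x) : P).
Local Notation I := (sr_ideal K (simplex_boundary V)).
Implicit Types (p g : P) (s : seq X).

Lemma notin_simplex_boundary (A : {set X}) :
  (A \notin simplex_boundary V) = (A == V) || ~~ (A \subset V).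
Proof. by rewrite !inE negb_and negbK. Qed.

Lemma boundary_ideal_min J : is_ideal J -> J (sqfree_monomial K V) ->
  (forall x, x \notin V -> J (var x)) -> forall p, I p -> J p.
Proof.
move=> idJ JV Jx; apply: ideal_gen_min => // _ [A + ->].
rewrite notin_simplex_boundary => /orP[/eqP-> // | /subsetPn[x xA /Jx Jvx]].
by rewrite /sqfree_monomial (bigD1 x) //= mulrC; case: idJ => _ _; apply.
Qed.

Lemma mem_boundary_full : I (sqfree_monomial K V).
Proof. by apply: mem_ideal_gen; exists V => //; rewrite notin_simplex_boundary eqxx. Qed.

Lemma mem_boundary_ghost x : x \notin V -> I (var x).
Proof.
move=> xV; apply: mem_ideal_gen; exists [set x]; last by rewrite /sqfree_monomial big_set1.
by rewrite notin_simplex_boundary sub1set xV orbT.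
Qed.

Definition differences s : seq P := [seq var x - var v0 | x <- s].

Definition collapse_var s (x : X) : P :=
  if x \notin V then 0 else if x \in s then var v0 else var x.

Definition collapse s : P -> P :=
  mmap (@mpolyC n K) (fun i => collapse_var s (enum_val i)).

HB.instance Definition _ s := GRing.RMorphism.on (collapse s).

Lemma collapseX s x : collapse s (var x) = collapse_var s x.
Proof. by rewrite /collapse mmapXU enum_rankK. Qed.

Definition collapsed_monomial s : P :=
  \prod_(x in V) var (if x \in s then v0 else x).

Lemma collapse_full s : collapse s (sqfree_monomial K V) = collapsed_monomial s.
Proof.
rewrite rmorph_prod; apply: eq_bigr => x xV.
by rewrite [LHS]collapseX /collapse_var xV /=; case: ifP.
Qed.

(** Killing the ghost variables and identifying the variables in [s] with that of
    [v0] is a retraction onto a polynomial ring that carries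
    [I + (differences s)] to the principal ideal of one monomial. *)
Lemma mem_boundary_differences s p : {subset s <= V} ->
  ideal_add I (differences s) p <-> exists g, collapse s p = collapsed_monomial s * g.
Proof.
move=> sV; split.
  apply: (@ideal_gen_min _ _ _ (fun p => exists g, collapse s p = collapsed_monomial s * g)).
    exact: (preim_principal_ideal (collapse s)).
  move=> q [|/mapP[x xs ->]].
    apply: (@boundary_ideal_min
      (fun q => exists g, collapse s q = collapsed_monomial s * g)) => [||x xV].
    - exact: (preim_principal_ideal (collapse s)).
    - by exists 1; rewrite mulr1 collapse_full.
    - by exists 0; rewrite mulr0 collapseX /collapse_var xV.
  exists 0; rewrite mulr0 rmorphB /= !collapseX /collapse_var xs (sV _ xs) v0V /=.
  by case: ifP; rewrite subrr.
have idJ := ideal_add_ideal I (differences s); set J := ideal_add _ _ in idJ *.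
have sJ := ideal_subspace idJ.
have congJ : forall q, J (q - collapse s q).
  apply: (@subst_congr _ _ _ (collapse s)) => // [c | i]; first exact: mmapC.
  rewrite -(enum_valK i) /= collapseX /collapse_var.
  have [xV | xV] /= := boolP (enum_val i \in V); last first.
    by rewrite subr0; apply/ideal_add_sub/mem_boundary_ghost.
  case: ifP => xs; last by rewrite subrr; case: idJ.
  by apply: mem_ideal_add; apply: map_f.
move=> [g pE]; apply: (subspaceBK sJ (congJ p)); rewrite pE mulrC.
case: (idJ) => _ _; apply; rewrite -collapse_full -[X in J X](subKr (sqfree_monomial K V)).
apply: subspaceB => //; exact/ideal_add_sub/mem_boundary_full.
Qed.

Lemma collapse_difference s x : x \in V -> x \notin s ->
  collapse s (var x - var v0) = var x - var v0.
Proof.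
move=> xV xs; rewrite rmorphB /= !collapseX /collapse_var xV (negPf xs) v0V /=.
by case: ifP.
Qed.

Lemma kill_difference (i : 'I_n) x y : x != y -> kill (pred1 i) (var x - var y) != 0.
Proof.
move=> ne; rewrite rmorphB /= !killX /=.
have Xnz (z : X) : var z != 0 by rewrite -msize_poly_eq0 msizeX.
have ne' : enum_rank x != enum_rank y by rewrite (inj_eq enum_rank_inj).
have [xi | _] := eqVneq (enum_rank x) i.
  have /negPf-> : enum_rank y != i by rewrite -xi eq_sym.
  by rewrite sub0r oppr_eq0 Xnz.
have [_ | _] := eqVneq (enum_rank y) i; first by rewrite subr0 Xnz.
rewrite subr_eq0; apply: contra ne' => /eqP/(congr1 (fun p => p@_U_(enum_rank x))).
rewrite !mcoeffXU eqxx eq_sym; case: eqP => // _ /eqP.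
by rewrite oner_eq0.
Qed.

(** The element [var x - var v0] is fixed by the retraction [collapse s] and no
    variable divides it, so it can be cancelled against the monomial
    [collapsed_monomial s]. *)
Lemma boundary_differences_regular s x g : {subset s <= V} ->
  x \in V -> x \notin s -> x != v0 ->
  ideal_add I (differences s) ((var x - var v0) * g) -> ideal_add I (differences s) g.
Proof.
move=> sV xV xs xv0 /(mem_boundary_differences _ sV)[q].
rewrite rmorphM /= collapse_difference // => Eq; apply/mem_boundary_differences => //.
move: Eq; rewrite /collapsed_monomial -big_enum.
rewrite -(big_map (fun x => enum_rank (if x \in s then v0 else x)) xpredT (fun i => 'X_i)).
by apply: prod_var_gauss => i _; apply: kill_difference.
Qed.

Local Notation J := (ideal_add I (differences (enum (V :\ v0)))).

Lemma one_notin_boundary_differences : ~ J 1.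
Proof.
move/mem_boundary_differences => [x|g]; first by rewrite mem_enum => /setD1P[].
rewrite rmorph1 /collapsed_monomial (bigD1 v0) //=; set y := if _ then _ else _.
move/(congr1 (kill (pred1 (enum_rank y)))); rewrite !rmorphM rmorph1 /= killX /= eqxx !mul0r.
by move/eqP; rewrite oner_eq0.
Qed.

Definition eval_var (x : X) : {poly K} := if x \in V then 'X else 0.

Definition univariate : P -> {poly K} :=
  mmap (@polyC K) (fun i => eval_var (enum_val i)).

HB.instance Definition _ := GRing.RMorphism.on univariate.

Lemma univariateX x : univariate (var x) = eval_var x.
Proof. by rewrite /univariate mmapXU enum_rankK. Qed.

Lemma univariateZ c p : univariate (c *: p) = c *: univariate p.
Proof. by rewrite /univariate mmapZ mul_polyC. Qed.

Lemma univariate_full : univariate (sqfree_monomial K V) = 'X^#|V|.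
Proof.
rewrite rmorph_prod -prodr_const; apply: eq_bigr => x xV.
by rewrite [LHS]univariateX /eval_var xV.
Qed.

(** The artinian reduction is K[t]/(t^|V|). *)
Lemma mem_artinian_reduction p :
  J p <-> forall l, (l < #|V|)%N -> (univariate p)`_l = 0.
Proof.
split=> [Jp l ltl | low0].
  suff [g ->] : exists g : {poly K}, univariate p = 'X^#|V| * g by rewrite coefXnM ltl.
  apply: (@ideal_gen_min _ _ _ (fun p => exists g : {poly K}, univariate p = 'X^#|V| * g)) Jp.
    exact: (preim_principal_ideal univariate).
  move=> q [|/mapP[x]].
    apply: (@boundary_ideal_min
      (fun q => exists g : {poly K}, univariate q = 'X^#|V| * g)) => [||x xV].
    - exact: (preim_principal_ideal univariate).
    - by exists 1; rewrite mulr1 univariate_full.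
    - by exists 0; rewrite mulr0 univariateX /eval_var (negPf xV).
  rewrite mem_enum => /setD1P[_ xV] ->; exists 0.
  by rewrite mulr0 rmorphB /= !univariateX /eval_var xV v0V subrr.
have idJ := ideal_add_ideal I (differences (enum (V :\ v0))).
have sJ := ideal_subspace idJ.
pose back : {poly K} -> P := horner_eval (var v0) \o map_poly (@mpolyC n K).
pose f : {rmorphism P -> P} := horner_eval (var v0) \o map_poly (@mpolyC n K) \o univariate.
have congJ : forall q, J (q - f q).
  apply: subst_congr => // [c | i].
    by rewrite /f /= /univariate mmapC map_polyC /horner_eval hornerC.
  rewrite -(enum_valK i) /f /= univariateX /eval_var.
  have [xV | xV] := boolP (enum_val i \in V); last first.
    rewrite map_poly0 /horner_eval horner0 subr0.
    by apply/ideal_add_sub/mem_boundary_ghost.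
  rewrite map_polyX /horner_eval hornerX.
  have [-> | ne] := eqVneq (enum_val i) v0; first by rewrite subrr; case: idJ.
  by apply: mem_ideal_add; apply: map_f; rewrite mem_enum !inE ne.
have JXn : J (var v0 ^+ #|V|).
  have -> : var v0 ^+ #|V| = f (sqfree_monomial K V).
    by rewrite /f /= univariate_full map_polyXn /horner_eval hornerXn.
  rewrite -[X in J X](subKr (sqfree_monomial K V)).
  by apply: subspaceB => //; exact/ideal_add_sub/mem_boundary_full.
apply: (subspaceBK sJ (congJ p)).
have uE : univariate p = drop_poly #|V| (univariate p) * 'X^#|V|.
  rewrite -[LHS](poly_take_drop #|V|) [take_poly _ _](_ : _ = 0) ?add0r //.
  by apply/polyP => l; rewrite coef_take_poly coef0; case: ifP => // /low0.
have -> : f p = back (drop_poly #|V| (univariate p)) * var v0 ^+ #|V|.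
  by rewrite /f /back /= {1}uE rmorphM /= map_polyXn /horner_eval hornerM hornerXn.
by case: idJ => _ _; apply.
Qed.


Lemma quot_dim_artinian_reduction : quot_dim (fun _ => True) J #|V|.
Proof.
exists (fun i => var v0 ^+ i).
have uX i : univariate (var v0 ^+ i) = 'X^i by rewrite rmorphXn /= univariateX /eval_var v0V.
have usum (a : 'I_#|V| -> K) (l : 'I_#|V|) :
    (univariate (\sum_i a i *: var v0 ^+ i))`_l = a l.
  rewrite rmorph_sum coef_sum (bigD1 l) //= univariateZ uX coefZ coefXn eqxx mulr1.
  rewrite big1 ?addr0 // => i /negPf ne.
  by rewrite univariateZ uX coefZ coefXn (inj_eq val_inj) eq_sym ne mulr0.
split=> // [p _ | a /mem_artinian_reduction Ja l]; last by rewrite -usum Ja.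
exists (fun i => (univariate p)`_i); apply/mem_artinian_reduction => l ltl.
by rewrite rmorphB coefB /= (usum _ (Ordinal ltl)) subrr.
Qed.

(** In K[t]/(t^|V|) the socle is the line of t^(|V| - 1). *)
Lemma quot_dim_socle : quot_dim (socle J) J 1.
Proof.
have V_gt0 : (0 < #|V|)%N by apply/card_gt0P; exists v0.
have uX i : univariate (var v0 ^+ i) = 'X^i by rewrite rmorphXn /= univariateX /eval_var v0V.
exists (fun _ => var v0 ^+ #|V|.-1); split.
- move=> _ i; apply/mem_artinian_reduction => l ltl.
  rewrite -(enum_valK i) rmorphM /= univariateX uX /eval_var.
  case: ifP => _; last by rewrite mul0r coef0.
  by rewrite -exprS prednK // coefXn ltn_eqF.
- move=> p socp; exists (fun _ => (univariate p)`_(#|V|.-1)).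
  apply/mem_artinian_reduction => l ltl; rewrite big_ord1 rmorphB /= univariateZ uX.
  rewrite coefB coefZ coefXn.
  have [-> | ne] := eqVneq l #|V|.-1; first by rewrite mulr1 subrr.
  rewrite mulr0 subr0; have ltlV : (l.+1 < #|V|)%N.
    by rewrite -(prednK V_gt0) ltnS ltn_neqAle ne -ltnS prednK.
  have /mem_artinian_reduction/(_ _ ltlV) := socp (enum_rank v0).
  by rewrite rmorphM /= univariateX /eval_var v0V coefXM.
move=> a /mem_artinian_reduction/(_ #|V|.-1); rewrite big_ord1 univariateZ uX.
rewrite coefZ coefXn eqxx mulr1 prednK // => /(_ (leqnn _)) a0 i; by rewrite ord1.
Qed.

(** For j < |V| the variables outside V and the first j + 1 variables of V generate
    a prime over [I]. Conversely every prime over [I] contains the variables outside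
    V and one variable of V, so [prime_chain_leq] bounds the chains. *)
Lemma krull_dim_boundary : krull_dim I #|V|.-1.
Proof.
have V_gt0 : (0 < #|V|)%N by apply/card_gt0P; exists v0.
split.
  pose s := enum V; have size_s : size s = #|V| by rewrite -cardE.
  pose D i := [pred x | (enum_val x \notin V) || (enum_val x \in take i.+1 s)] : pred 'I_n.
  have DE i x : D i (enum_rank x) = (x \notin V) || (x \in take i.+1 s).
    by rewrite /D /= enum_rankK.
  have idker i : prime_ideal (fun p => kill (D i) p = 0) := rmorph_ker_prime (kill (D i)).
  have DS i x : D i x -> D i.+1 x.
    move=> /orP[xV | xs]; apply/orP; [by left | right].
    have tkE : take i.+1 s = take i.+1 (take i.+2 s) by rewrite -take_min (minn_idPl _).
    by move: xs; rewrite tkE => /mem_take.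
  exists (fun i p => kill (D i) p = 0); split=> [i _ | i p _ | i lti].
  - exact: idker.
  - move: p; apply: (@boundary_ideal_min (fun q => kill (D i) q = 0)).
    + by case: (idker i).
    + have hV : nth v0 s 0 \in V by rewrite -mem_enum mem_nth // size_s.
      rewrite rmorph_prod (bigD1 (nth v0 s 0)) //= killX DE.
      rewrite (_ : _ || _) ?mul0r //; apply/orP; right.
      by rewrite -(nth_take v0 (ltn0Sn i)) mem_nth // size_take size_s; case: ifP.
    + by move=> x xV; rewrite killX DE xV.
  have lti1 : (i.+1 < size s)%N by rewrite size_s -(prednK V_gt0) ltnS.
  split=> [p ki|].
    have [idk _ _] := idker i.+1; have := @kill_congr K n (D i) _ idk _ p.
    rewrite ki subr0; apply=> x /DS Dx; by rewrite killX Dx.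
  exists (var (nth v0 s i.+1)); rewrite killX DE.
    by rewrite (take_nth v0 lti1) mem_rcons mem_head orbT.
  have -> : nth v0 s i.+1 \in V by rewrite -mem_enum mem_nth.
  rewrite in_take ?mem_nth // index_uniq ?enum_uniq // ltnn /= => /eqP.
  by rewrite -msize_poly_eq0 msizeX.
move=> d [Q [primeQ IQ chainQ]].
have [idQ nQ1 primeQ0] := primeQ 0%N isT.
have [x xV Qx] : exists2 x, x \in V & Q 0%N (var x).
  have := IQ 0%N _ isT mem_boundary_full; rewrite /sqfree_monomial -big_enum.
  have: all (mem V) (enum V) by apply/allP => x; rewrite mem_enum.
  elim: (enum V) => [|x s IH] /=; first by rewrite big_nil.
  by case/andP=> xV sV; rewrite big_cons => /primeQ0[Qx | /(IH sV)]; first by exists x.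
have -> : #|V|.-1 = #|[set enum_rank y | y in V :\ x]|.
  by rewrite card_imset; [rewrite (cardsD1 x V) xV | exact: enum_rank_inj].
apply: (prime_chain_leq primeQ chainQ) => i; rewrite -(enum_valK i) => iV.
have [-> // | ne] := eqVneq (enum_val i) x.
apply: IQ => //; apply: mem_boundary_ghost; apply: contra iV => iV.
by apply/imsetP; exists (enum_val i); rewrite ?inE ?ne ?iV.
Qed.

Lemma gorenstein_boundary : gorenstein I.
Proof.
have sz : size (enum (V :\ v0)) = #|V|.-1 by rewrite -cardE (cardsD1 v0 V) v0V.
exists (differences (enum (V :\ v0))); split; last exact: quot_dim_socle.
  split; last by exists #|V|; apply: quot_dim_artinian_reduction.
    move=> _ /mapP[x _ ->]; exists 1%N => //.
    have homX (y : X) : var y \is 1.-homog by rewrite dhomogX /= mdeg1.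
    by rewrite rpredB ?homX.
  by rewrite size_map sz; apply: krull_dim_boundary.
split=> [|i]; first exact: one_notin_boundary_differences.
rewrite size_map => lti g; rewrite (nth_map v0) // -map_take.
have := mem_nth v0 lti; rewrite mem_enum => /setD1P[ne xV].
apply: boundary_differences_regular => // [x /mem_take|].
  by rewrite mem_enum => /setD1P[].
by rewrite in_take ?mem_nth // index_uniq ?enum_uniq ?ltnn.
Qed.

End SimplexBoundary.

(** * Binomial inequalities *)

Lemma bin_supermodular s p q j :
  ('C(s + p, j) + 'C(s + q, j) <= 'C(s + p + q, j) + 'C(s, j))%N.
Proof.
elim: q => [|q IH]; first by rewrite !addn0.
case: j IH => [|j] IH; first by rewrite !bin0.
rewrite !addnS !binS.
have le : ('C(s + q, j) <= 'C(s + p + q, j))%N by apply: leq_bin2l; lia.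
lia.
Qed.

(** For r > 0 let A and B have a - 1 and b - 1 elements, r - 1 of them common: among
    the subsets of size j + 2 of the union, those that contain a fixed point of A - B
    and a fixed point of B - A lie neither in A nor in B. For r = 0 let A and B be
    disjoint and add a point z to their union: the subsets that contain z and another
    fixed point lie neither in A nor in B. *)
Lemma bin_glue_leq a b r j : (r < a)%N -> (r < b)%N -> (3 <= a + b - r)%N ->
  ('C(a.-1, j.+2) + 'C(b.-1, j.+2) + 'C((a + b - r) - 3, j)
    <= 'C((a + b - r).-1, j.+2) + 'C(r.-1, j.+2))%N.
Proof.
case: r => [|s].
  case: a => // p; case: b => // q _ _.
  rewrite subn0 addSn addnS /= => pq_gt0.
  have := bin_supermodular 0 p q j.+2; rewrite !add0n bin0n /= => sup.
  rewrite binS; have -> : ((p + q).+2 - 3 = (p + q).-1)%N by lia.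
  have -> : 'C(p + q, j.+1) = ('C((p + q).-1, j.+1) + 'C((p + q).-1, j))%N.
    by rewrite -binS prednK //; lia.
  lia.
move=> lta ltb _; pose p := (a - s.+2)%N; pose q := (b - s.+2)%N.
have -> : a = (s + p).+2 by rewrite /p; lia.
have -> : b = (s + q).+2 by rewrite /q; lia.
have -> : ((s + p).+2 + (s + q).+2 - s.+1 = (s + p + q).+3)%N by lia.
rewrite /= subSS subSS subSS subn0 !binS.
have := bin_supermodular s p q j.+2.
have le1 : ('C(s + p, j.+1) <= 'C(s + p + q, j.+1))%N by apply: leq_bin2l; lia.
have le2 : ('C(s + q, j.+1) <= 'C(s + p + q, j.+1))%N by apply: leq_bin2l; lia.
lia.
Qed.

Lemma bin2_double m : (2 * 'C(m, 2) = m * m.-1)%N.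
Proof. by rewrite bin2 mul2n halfK; case: m => // m; rewrite /= oddM /= andNb subn0. Qed.

(** Here the excess counts the pairs that lie in neither part: it is
    (a - r) (b - r) if r > 0, and a b - 1 if r = 0. *)
Lemma bin_glue_eq1 a b r : (r < a)%N -> (r < b)%N -> (4 <= a + b - r)%N ->
  ('C((a + b - r).-1, 2) + 'C(r.-1, 2) = ('C(a.-1, 2) + 'C(b.-1, 2)).+1)%N ->
  a = r.+1 /\ b = r.+1.
Proof.
move=> lta ltb le4 E.
have := bin2_double (a + b - r).-1; have := bin2_double r.-1.
have := bin2_double a.-1; have := bin2_double b.-1; move: E.
move: 'C(_, 2) 'C(_, 2) 'C(_, 2) 'C(_, 2) => c1 c2 c3 c4 E e1 e2 e3 e4.
have {E e1 e2 e3 e4} : ((a + b - r).-1 * (a + b - r).-1.-1 + r.-1 * r.-1.-1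
   = a.-1 * a.-1.-1 + b.-1 * b.-1.-1 + 2)%N by lia.
case: r lta ltb le4 => [|s] lta ltb le4.
  case: a lta le4 => // p _; case: b ltb => // q _ le4.
  rewrite subn0 addSn addnS /= => E.
  suff : (p * q + p + q = 1)%N by nia.
  by case: p q le4 E => [|p] [|q] /=; nia.
pose p := (a - s.+2)%N; pose q := (b - s.+2)%N.
have aE : a = (s + p).+2 by rewrite /p; lia.
have bE : b = (s + q).+2 by rewrite /q; lia.
clearbody p q; rewrite {}aE {}bE in lta ltb le4 *.
have -> : ((s + p).+2 + (s + q).+2 - s.+1 = (s + p + q).+3)%N by lia.
move=> /= E; suff : (p.+1 * q.+1 = 1)%N by nia.
by case: s E {lta ltb le4} => [|s] /=; nia.
Qed.

Lemma bin_ge2 m i : (0 < i < m)%N -> (2 <= 'C(m, i))%N.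
Proof.
case: m i => [|m] [|i] //= lti; rewrite binS.
have : (0 < 'C(m, i.+1))%N by rewrite bin_gt0.
have : (0 < 'C(m, i))%N by rewrite bin_gt0; lia.
lia.
Qed.

Lemma binz_pred (a j : nat) : (0 < j)%N -> binz (a%:Z - 1) j%:Z = 'C(a.-1, j)%:Z.
Proof.
case: a => [|a] j_gt0; first by rewrite bin0n eqn0Ngt j_gt0.
by have -> : a.+1%:Z - 1 = a%:Z by lia.
Qed.

(** * Valuations along a leaf order *)

Lemma in_bigcup_seq (X : finType) (s : seq {set X}) x :
  (x \in \bigcup_(T <- s) T) = has (fun T : {set X} => x \in T) s.
Proof. by elim: s => [|T s IH]; rewrite ?big_nil ?inE // big_cons inE IH. Qed.

Lemma sub_bigcup_seq (X : finType) (s : seq {set X}) (T : {set X}) :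
  T \in s -> T \subset \bigcup_(T <- s) T.
Proof.
by move=> Ts; apply/subsetP => x xT; rewrite in_bigcup_seq; apply/hasP; exists T.
Qed.

Section LeafSequence.
Variables (X : finType) (S : seq {set X}).
Implicit Types (A C : {set X}).

Local Notation Snth m := (nth set0 S m).
Local Notation sep m := (separator S m).

(** Each separator lies in a single earlier set, so that a new set is attached to
    the complex of the earlier ones along one full simplex. *)
Definition leaf_sequence : Prop := forall m, (0 < m < size S)%N ->
  exists2 p, (p < m)%N & sep m \subset Snth p.

Hypothesis leafS : leaf_sequence.

Definition faces_upto m : {set {set X}} :=
  [set C : {set X} | has (fun T : {set X} => C \subset T) (take m S)].

Lemma faces_uptoS m : (m < size S)%N ->
  faces_upto m.+1 = faces_upto m :|: powerset (Snth m).
Proof.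
move=> ltm; apply/setP => C.
by rewrite !inE (take_nth set0 ltm) -cats1 has_cat /= orbF.
Qed.

Lemma subset_separator m : sep m \subset Snth m.
Proof. exact: subsetIr. Qed.

(** A face of [S_m] that lies in an earlier facet lies in the separator; conversely
    the separator lies in one earlier facet. *)
Lemma faces_uptoI m : (0 < m < size S)%N ->
  faces_upto m :&: powerset (Snth m) = powerset (sep m).
Proof.
move=> mS; apply/setP => C; rewrite !inE; apply/andP/idP => [[/hasP[T Tm CT] CS] | Csep].
  by rewrite subsetI CS (subset_trans CT) // (sub_bigcup_seq Tm).
split; last exact: subset_trans Csep (subset_separator m).
have [p ltpm sepp] := leafS mS; case/andP: mS => m_gt0 ltm.
apply/hasP; exists (Snth p); last exact: subset_trans Csep sepp.
by rewrite -(nth_take set0 ltpm) mem_nth // size_take ltm.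
Qed.

Lemma sum_setU (V : zmodType) (T : finType) (B D : {set T}) (w : T -> V) :
  \sum_(x in B :|: D) w x
    = \sum_(x in B) w x + \sum_(x in D) w x - \sum_(x in B :&: D) w x.
Proof.
rewrite (big_setID B) /= setUK setDUl setDv set0U [in RHS](big_setID (A := D) B) /=.
by rewrite [B :&: D]setIC -[RHS]addrA; congr (_ + _); rewrite addrAC subrr add0r.
Qed.

(** Adding the facet [S_m] glues a simplex along the full simplex on the
    separator, so every valuation is additive along the order. *)
Lemma valuation_faces_upto (V : zmodType) (w : {set X} -> V) m :
  (0 < m <= size S)%N ->
  \sum_(C in faces_upto m) w C
    = \sum_(0 <= i < m) \sum_(C in powerset (Snth i)) w C
      - \sum_(1 <= i < m) \sum_(C in powerset (sep i)) w C.
Proof.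
case: m => // m /=; elim: m => [|m IH] ltm.
  rewrite big_nat1 big_geq // subr0; apply: eq_bigl => C.
  by rewrite !inE (take_nth set0 ltm) take0 /= orbF.
rewrite faces_uptoS // sum_setU faces_uptoI // IH ?(ltnW ltm) //.
rewrite [X in _ = X - _]big_nat_recr //= [X in _ = _ - X]big_nat_recr //=.
rewrite opprD !addrA; congr (_ - _).
by rewrite addrAC.
Qed.

Definition union_upto m : {set X} := \bigcup_(T <- take m S) T.

Lemma union_uptoS m : (m < size S)%N -> union_upto m.+1 = union_upto m :|: Snth m.
Proof. by move=> ltm; rewrite /union_upto (take_nth set0 ltm) -cats1 big_cat big_seq1. Qed.

Lemma card_union_uptoS m : (m < size S)%N ->
  #|union_upto m.+1| = (#|union_upto m| + #|Snth m| - #|sep m|)%N.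
Proof. by move=> ltm; rewrite union_uptoS // cardsU. Qed.

Hypothesis irredundant : forall i j, (i < size S)%N -> (j < size S)%N ->
  Snth i \subset Snth j -> i = j.

Lemma separator_small m : (0 < m < size S)%N ->
  (#|sep m| < #|union_upto m|)%N /\ (#|sep m| < #|Snth m|)%N.
Proof.
move=> mS; have [p ltpm sepp] := leafS mS; case/andP: (mS) => m_gt0 ltm.
have ltp := ltn_trans ltpm ltm.
split; apply/proper_card.
  have sub : Snth p \subset union_upto m.
    apply: sub_bigcup_seq; by rewrite -(nth_take set0 ltpm) mem_nth // size_take ltm.
  rewrite properE (subset_trans sepp sub); apply/negP => /(subset_trans sub) ps.
  have := irredundant ltp ltm (subset_trans ps (subset_separator m)).
  by move=> E; rewrite E ltnn in ltpm.
rewrite properE subset_separator; apply/negP => /subset_trans/(_ sepp).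
by move/(irredundant ltm ltp) => E; rewrite -E ltnn in ltpm.
Qed.

(** The number tau of the complex of the first [m] facets on its own vertices, with
    [j] in the role of N - k - 2. *)
Definition partial_tau j m : int :=
  'C(#|union_upto m|.-1, j)%:Z - \sum_(0 <= i < m) 'C(#|Snth i|.-1, j)%:Z
  + \sum_(1 <= i < m) 'C(#|sep i|.-1, j)%:Z.

Lemma partial_tau1 j : (0 < size S)%N -> partial_tau j 1 = 0.
Proof.
move=> S_gt0; rewrite /partial_tau big_nat1 big_geq // addr0.
by rewrite union_uptoS // /union_upto take0 big_nil set0U subrr.
Qed.

Lemma partial_tauS j m : (0 < m < size S)%N -> partial_tau j m.+1 = partial_tau j m
  + ('C((#|union_upto m| + #|Snth m| - #|sep m|).-1, j)%:Z + 'C(#|sep m|.-1, j)%:Z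
     - 'C(#|union_upto m|.-1, j)%:Z - 'C(#|Snth m|.-1, j)%:Z).
Proof.
move=> /andP[m_gt0 ltm]; rewrite /partial_tau card_union_uptoS //.
rewrite big_nat_recr //= [X in _ + X = _]big_nat_recr //=.
ring.
Qed.

Lemma partial_tau_step j m : (0 < m < size S)%N -> (3 <= #|union_upto m.+1|)%N ->
  partial_tau j.+2 m + 'C(#|union_upto m.+1| - 3, j)%:Z <= partial_tau j.+2 m.+1.
Proof.
move=> mS; have [ltU ltS] := separator_small mS; case/andP: (mS) => m_gt0 ltm.
rewrite card_union_uptoS // partial_tauS // => le3.
have := bin_glue_leq j ltU ltS le3; lia.
Qed.

(** The only step not covered by [partial_tau_step] adds a second isolated vertex,
    and its increment is zero. *)
Lemma partial_tau_ge0 j m : (0 < m <= size S)%N -> 0 <= partial_tau j.+2 m.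
Proof.
case: m => // m /=; elim: m => [|m IH] ltm; first by rewrite partial_tau1.
have mS : (0 < m.+1 < size S)%N by rewrite ltm.
have [le3 | lt3] := leqP 3 #|union_upto m.+2|.
  have := partial_tau_step j mS le3; have := IH (ltnW ltm); lia.
have [ltU ltS] := separator_small mS; move: lt3; rewrite card_union_uptoS // => lt3.
rewrite partial_tauS //; have := IH (ltnW ltm).
have -> : #|sep m.+1| = 0%N by lia.
have -> : #|union_upto m.+1| = 1%N by lia.
have -> : #|Snth m.+1| = 1%N by lia.
by rewrite /= !bin_small //; lia.
Qed.

Lemma partial_tau_lower j : (2 <= size S)%N -> (3 <= #|union_upto (size S)|)%N ->
  'C(#|union_upto (size S)| - 3, j)%:Z <= partial_tau j.+2 (size S).
Proof.
case E : (size S) => [|[|m]] // _ le3.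
have mS : (0 < m.+1 < size S)%N by rewrite E /=.
have m1 : (0 < m.+1 <= size S)%N by rewrite E /=.
have := partial_tau_step j mS le3; have := partial_tau_ge0 j m1; lia.
Qed.

(** When [j = 2] each gluing step past two vertices adds at least one, so the
    value one forces a single step, and that step glues two simplices along a
    common facet. *)
Lemma partial_tau_eq1 : (2 <= size S)%N -> (4 <= #|union_upto (size S)|)%N ->
  partial_tau 2 (size S) = 1 ->
  [/\ size S = 2, #|Snth 0| = #|union_upto (size S)|.-1,
      #|Snth 1| = #|union_upto (size S)|.-1
    & #|sep 1| = #|union_upto (size S)|.-2].
Proof.
case E : (size S) => [|[|m]] // _ le4 t1.
have mS : (0 < m.+1 < size S)%N by rewrite E /=.
have m1 : (0 < m.+1 <= size S)%N by rewrite E /=.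
have ltm : (m.+1 < size S)%N by rewrite E.
have le3 : (3 <= #|union_upto m.+2|)%N by apply: leq_trans le4.
have [ltU ltS] := separator_small mS.
have t_step := partial_tau_step 0 mS le3; rewrite bin0 t1 in t_step.
have t_ge0 := partial_tau_ge0 0 m1.
have t0 : partial_tau 2 m.+1 = 0 by lia.
have := partial_tauS 2 mS; rewrite t1 t0 add0r => inc1.
have cardU := card_union_uptoS ltm.
have [Ur Sr] : #|union_upto m.+1| = #|sep m.+1|.+1 /\ #|Snth m.+1| = #|sep m.+1|.+1.
  apply: bin_glue_eq1 => //; first by rewrite -cardU.
  lia.
have m0 : m = 0%N.
  case: m E le4 t1 mS m1 ltm le3 ltU ltS t_step t_ge0 t0 inc1 cardU Ur Sr => // m.
  move=> E le4 _ _ _ ltm _ _ _ _ _ t0 _ cardU Ur Sr; exfalso.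
  have mS : (0 < m.+1 < size S)%N by rewrite (ltn_trans _ ltm).
  have m1 : (0 < m.+1 <= size S)%N by rewrite (ltnW (ltn_trans _ ltm)).
  have le3 : (3 <= #|union_upto m.+2|)%N by lia.
  have := partial_tau_step 0 mS le3; have := partial_tau_ge0 0 m1.
  by rewrite bin0 t0; lia.
subst m; split=> //; try lia.
have : #|union_upto 1| = #|Snth 0|.
  by rewrite union_uptoS ?E // /union_upto take0 big_nil set0U.
lia.
Qed.

End LeafSequence.

(** * Clique complexes with a leaf order *)

Section FaceSums.
Variable X : finType.
Implicit Types (A C : {set X}).

Lemma sum_powersetD1 (V : zmodType) A x (w : {set X} -> V) : x \in A ->
  \sum_(C in powerset A) w C = \sum_(C in powerset (A :\ x)) (w C + w (x |: C)).
Proof.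
move=> xA; rewrite (bigID (fun C : {set X} => x \in C)) /= addrC big_split /=.
congr (_ + _).
  by apply: eq_bigl => C; rewrite !inE subsetD1.
rewrite (reindex_onto (fun C => x |: C) (fun C => C :\ x)) /=; last first.
  by move=> C /andP[_ xC]; apply: setD1K.
apply: eq_bigl => C; rewrite !inE eqxx /= andbT subUset sub1set xA subsetD1 /=.
congr (_ && _); apply/eqP/idP => [<- | xC]; last exact: setU1K.
by rewrite !inE eqxx.
Qed.

Lemma sum_powerset_card j A :
  \sum_(C in powerset A) (#|C| == j)%:R = 'C(#|A|, j)%:Z.
Proof.
rewrite -cards_draws -natz -sum1_card natr_sum [LHS]big_mkcond [RHS]big_mkcond /=.
by apply: eq_bigr => C _; rewrite !inE; case: (C \subset A) => //; case: eqP.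
Qed.

(** For F the complement of C and d = |X| - j - 1, this is (-1)^(d - |F|) if
    |F| <= d and 0 otherwise. *)
Definition skeleton_sign (j : nat) C : int :=
  if (j < #|C|)%N then (-1) ^+ (#|C| - j.+1) else 0.

(** The signs of C and of C with one more point cancel unless |C| = j. *)
Lemma sum_skeleton_sign j A : (0 < j)%N ->
  \sum_(C in powerset A) skeleton_sign j C = 'C(#|A|.-1, j)%:Z.
Proof.
move=> j_gt0; have [-> | [x xA]] := set_0Vmem A.
  rewrite cards0 powerset0 big_set1 /skeleton_sign cards0 bin0n.
  by case: j j_gt0.
rewrite (sum_powersetD1 _ xA) (cardsD1 x A) xA add1n -sum_powerset_card.
apply: eq_bigr => C; rewrite inE subsetD1 => /andP[_ xC].
rewrite /skeleton_sign cardsU1 xC add1n.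
have [ltj | gtj | <-] := ltngtP j #|C|.
- by rewrite ltnS (ltnW ltj) subSS -(subnSK ltj) exprS mulN1r subrr.
- by rewrite ltnS leqNgt gtj add0r.
by rewrite ltnSn subnn add0r.
Qed.

End FaceSums.

Section CliqueComplex.
Variables (X : finType) (adj : rel X) (S : seq {set X}).
Hypothesis adj_sym : ssrbool.symmetric adj.
Hypothesis S_leaf : leaf_order (clique_complex adj) S.
Implicit Types (A C : {set X}).

Local Notation Delta := (clique_complex adj).
Local Notation Snth m := (nth set0 S m).
Local Notation sep m := (separator S m).

Lemma clique_sub A C : C \in Delta -> A \subset C -> A \in Delta.
Proof.
rewrite !inE => /forallP clC /subsetP AC; apply/forallP => x; apply/implyP => xA.
apply/forallP => y; apply/implyP => yA.
by have /implyP/(_ (AC _ xA))/forallP/(_ y)/implyP/(_ (AC _ yA)) := clC x.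
Qed.

Lemma cliqueP A : reflect {in A &, forall x y, x != y -> adj x y} (A \in Delta).
Proof.
rewrite inE; apply: (iffP forall_inP) => [cl x y xA yA | cl x xA].
  by have /forall_inP/(_ y yA)/implyP := cl x xA.
by apply/forall_inP => y yA; apply/implyP; apply: cl.
Qed.

Lemma clique1 x : [set x] \in Delta.
Proof. by apply/cliqueP => y z; rewrite !inE => /eqP-> /eqP->; rewrite eqxx. Qed.

Lemma clique2 x y : x != y -> ([set x; y] \in Delta) = adj x y.
Proof.
move=> xy; apply/cliqueP/idP => [cl | axy u v].
  by apply: cl => //; rewrite !inE eqxx ?orbT.
by rewrite !inE => /orP[] /eqP-> /orP[] /eqP->; rewrite ?eqxx // adj_sym.
Qed.

Lemma mem_facets T : (T \in S) = (T \in facets Delta).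
Proof. by case: S_leaf. Qed.

Lemma facet_clique m : (m < size S)%N -> Snth m \in Delta.
Proof.
move=> ltm; have := mem_nth set0 ltm; rewrite mem_facets inE.
by case/maxsetP.
Qed.

Lemma facet_cover C : C \in Delta -> exists2 m, (m < size S)%N & C \subset Snth m.
Proof.
move=> /(maxset_exists (P := fun A => A \in Delta))[T maxT CT].
have TS : T \in S by rewrite mem_facets inE.
by exists (index T S); rewrite ?index_mem ?nth_index.
Qed.

Lemma facet_irredundant i j : (i < size S)%N -> (j < size S)%N ->
  Snth i \subset Snth j -> i = j.
Proof.
move=> lti ltj sub; have := mem_nth set0 lti; rewrite mem_facets inE => /maxsetP[_ maxi].
have eqij := maxi _ (facet_clique ltj) sub.
by case: S_leaf => uS _ _; apply/eqP; rewrite -(nth_uniq set0 lti ltj uS) eqij.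
Qed.

Lemma leaf_order_sequence : leaf_sequence S.
Proof.
move=> m mS; case: S_leaf => _ _ /(_ m mS)[p ltp leaf]; exists p => //.
apply/subsetP => x /setIP[]; rewrite in_bigcup_seq => /hasP[T /(nthP set0)[i]].
rewrite size_take => + <- xT xm; rewrite (andP mS).2 => lti.
rewrite nth_take // in xT.
have /subsetP/(_ x) := leaf i lti; rewrite !inE xm xT; exact.
Qed.

Lemma faces_upto_size : faces_upto S (size S) = Delta.
Proof.
apply/setP => C; rewrite !inE take_size.
apply/hasP/idP => [[T TS CT] | ].
  have [m ltm Tm] : exists2 m, (m < size S)%N & T = Snth m.
    by exists (index T S); rewrite ?index_mem ?nth_index.
  by have := clique_sub (facet_clique ltm); rewrite -Tm => /(_ C CT); rewrite inE.
move=> clC; have [|m ltm Cm] := @facet_cover C; first by rewrite inE.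
by exists (Snth m) => //; apply: mem_nth.
Qed.

Lemma union_upto_size : union_upto S (size S) = [set: X].
Proof.
apply/setP => x; rewrite in_bigcup_seq take_size inE.
have [m ltm xm] := facet_cover (clique1 x).
by apply/hasP; exists (Snth m); [apply: mem_nth | rewrite -sub1set].
Qed.

Lemma size_facets : size S = #|facets Delta|.
Proof. by case: S_leaf => uS eS _; rewrite -(card_uniqP uS); apply: eq_card. Qed.

(** ** Connected components *)

Definition starts_component (l : nat) : bool := (l == 0%N) || (sep l == set0).

Lemma facet_connect m x y : (m < size S)%N -> x \in Snth m -> y \in Snth m ->
  connect adj x y.
Proof.
move=> ltm xm ym; have [-> | ne] := eqVneq x y; first exact: connect0.
by apply: connect1; apply: (cliqueP _ (facet_clique ltm)).
Qed.

(** The label of a vertex is the index of the first facet of its component: a facet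
    with empty separator gets a new label, any other facet inherits that of its
    separator, which lies in one earlier facet and so carries only one label. *)
Lemma component_label m : (0 < m <= size S)%N -> exists rho : X -> nat,
  [/\ forall i x y, (i < m)%N -> x \in Snth i -> y \in Snth i -> rho x = rho y,
      forall i x, (i < m)%N -> x \in Snth i -> (rho x < m)%N && starts_component (rho x),
      forall i x y, (i < m)%N -> x \in Snth i -> y \in Snth (rho x) -> connect adj x y
    & forall l x, (l < m)%N -> starts_component l -> x \in Snth l -> rho x = l].
Proof.
case: m => // m /=; elim: m => [|m IH] ltm.
  exists (fun _ => 0%N); split=> // [[|i] x y // _ | [|l] x //].
  exact: facet_connect.
have [rho [same label conn start]] := IH (ltnW ltm).
have mS : (0 < m.+1 < size S)%N by rewrite ltm.
have sepP i x : (i < m.+1)%N -> x \in Snth i -> x \in Snth m.+1 -> x \in sep m.+1.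
  move=> lti xi xm; rewrite inE xm andbT in_bigcup_seq; apply/hasP.
  exists (Snth i) => //; rewrite -(nth_take set0 lti) mem_nth // size_take ltm //.
have [sep0 | [q qsep]] := set_0Vmem (sep m.+1).
  have new i x : (i < m.+1)%N -> x \in Snth i -> x \in Snth m.+1 = false.
    by move=> lti xi; apply/negP => /(sepP _ _ lti xi); rewrite sep0 inE.
  exists (fun x => if x \in Snth m.+1 then m.+1 else rho x).
  split=> [i x y | i x | i x y | l x]; rewrite ltnS leq_eqVlt => /predU1P[-> | lti].
  - by move=> -> ->.
  - by move=> xi yi; rewrite !(new i) //; apply: same xi yi.
  - by move=> ->; rewrite ltnSn /starts_component sep0 eqxx orbT.
  - move=> xi; rewrite (new i) //; have /andP[lt ->] := label i x lti xi.
    by rewrite ltnS (ltnW lt).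
  - by move=> xm; rewrite xm => ym; exact: (facet_connect ltm xm ym).
  - by move=> xi; rewrite (new i) //; exact: conn lti xi.
  - by move=> _ ->.
  - by move=> sl xi; rewrite (new l) //; exact: start.
have [p ltp /subsetP sepp] := leaf_order_sequence mS.
have qm : q \in Snth m.+1 by case/setIP: qsep.
have qp := sepp _ qsep.
pose rho' x := if x \in Snth m.+1 then rho q else rho x.
have old i x : (i < m.+1)%N -> x \in Snth i -> rho' x = rho x.
  move=> lti xi; rewrite /rho'; case: ifP => // /(sepP _ _ lti xi)/sepp xp.
  exact: same qp xp.
have newE x : x \in Snth m.+1 -> rho' x = rho q by rewrite /rho' => ->.
have /andP[ltq startq] := label p q ltp qp.
exists rho'; split=> [i x y | i x | i x y | l x]; rewrite ltnS leq_eqVlt => /predU1P[-> | lti].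
- by move=> xm ym; rewrite !newE.
- by move=> xi yi; rewrite !(old i) //; apply: same xi yi.
- by move=> xm; rewrite newE // ltnS (ltnW ltq).
- move=> xi; rewrite (old i) //; have /andP[lt ->] := label i x lti xi.
  by rewrite ltnS (ltnW lt).
- move=> xm; rewrite newE // => yq; apply: (connect_trans (y := q)).
    exact: (facet_connect ltm).
  exact: conn qp yq.
- by move=> xi; rewrite (old i) //; exact: conn lti xi.
- by rewrite /starts_component /= => /eqP sep0; rewrite sep0 inE in qsep.
- by move=> sl xi; rewrite (old l) //; exact: start.
Qed.

Lemma facet_neq0 m : (1 < size S)%N -> (m < size S)%N -> Snth m != set0.
Proof.
move=> S_gt1 ltm; have S_gt0 := ltnW S_gt1; apply: contraTneq isT => Sm0.
have eqm i : (i < size S)%N -> m = i.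
  by move=> lti; apply: facet_irredundant; rewrite // Sm0 sub0set.
by have := eqm 0%N S_gt0; rewrite (eqm 1%N S_gt1).
Qed.

(** The labels of [component_label] are constant on components, separate them, and
    take every index that starts a component as value. *)
Lemma num_components_leaf_order : (1 < size S)%N ->
  num_components adj = #|[set l : 'I_(size S) | starts_component l]|.
Proof.
move=> S_gt1; have S_gt0 := ltnW S_gt1.
have nonempty m ltm : Snth m != set0 := @facet_neq0 m S_gt1 ltm.
have [|rho [same label conn start]] := @component_label (size S).
  by rewrite S_gt0 leqnn.
have csym : connect_sym adj by apply: sym_connect_sym.
have cover x : exists2 m, (m < size S)%N & x \in Snth m.
  by have [m ltm] := facet_cover (clique1 x); rewrite sub1set; exists m.
have rho_adj x y : adj x y -> rho x = rho y.
  have [-> // | ne] := eqVneq x y; rewrite -(clique2 ne) => /facet_cover[m ltm].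
  by rewrite subUset !sub1set => /andP[]; apply: same.
have rho_connect x y : connect adj x y -> rho x = rho y.
  case/connectP => s path_s ->; elim: s x path_s => //= z s IH x /andP[xz /IH <-].
  exact: rho_adj.
have rho_lt x : (rho x < size S)%N.
  by have [m ltm xm] := cover x; case/andP: (label m x ltm xm).
have rho_start x : starts_component (rho x).
  by have [m ltm xm] := cover x; case/andP: (label m x ltm xm).
have rho_inj : {in roots adj &, injective (fun x => Ordinal (rho_lt x))}.
  move=> x y /eqP rx /eqP ry [Exy].
  have [z zx] : exists z, z \in Snth (rho x) by apply/set0Pn/nonempty.
  suff /(fingraph.rootP csym) : connect adj x y by rewrite rx ry.
  apply: (connect_trans (y := z)).
    by have [m ltm xm] := cover x; apply: conn ltm xm zx.
  rewrite csym; have [m ltm ym] := cover y; apply: conn ltm ym _.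
  by rewrite -Exy.
pose label_of x := Ordinal (rho_lt x).
rewrite /num_components /n_comp_mem.
rewrite -(card_in_imset (f := label_of) (D := predI (roots adj) predT)); last first.
  by move=> x y /andP[rx _] /andP[ry _]; apply: rho_inj.
apply: eq_card => l; rewrite inE; apply/imsetP/idP => [[x _ ->] | sl].
  exact: rho_start.
have [z zl] : exists z, z \in Snth l by apply/set0Pn/nonempty.
exists (fingraph.root adj z); first by rewrite inE /= roots_root.
by apply: val_inj; rewrite /= -(rho_connect _ _ (connect_root adj z)) (start l).
Qed.

End CliqueComplex.

(** ** Face numbers *)

Section FaceNumbers.
Variables (X : finType) (adj : rel X) (S : seq {set X}).
Hypothesis adj_sym : ssrbool.symmetric adj.
Hypothesis S_leaf : leaf_order (clique_complex adj) S.

Local Notation Delta := (clique_complex adj).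
Local Notation Snth m := (nth set0 S m).
Local Notation sep m := (separator S m).

(** The nonedges are the pairs that are not cliques. *)
Lemma card_compl_edges :
  #|edges (compl_graph adj)|%:Z = 'C(#|X|, 2)%:Z - #|[set C in Delta | #|C| == 2%N]|%:Z.
Proof.
rewrite -card_draws; pose pairs := [set A : {set X} | #|A| == 2%N].
rewrite -(cardsID Delta pairs) -/pairs.
have -> : pairs :&: Delta = [set C in Delta | #|C| == 2%N].
  by apply/setP => C; rewrite [LHS]inE [RHS]inE andbC [C \in pairs]inE.
have -> : edges (compl_graph adj) = pairs :\: Delta.
  apply/setP => A; rewrite [RHS]inE [A \in pairs]inE inE.
  apply/existsP/andP => [[x /existsP[y /andP[/andP[xy nadj] /eqP->]]]
    | [nA /cards2P[x [y [xy AE]]]]].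
    by rewrite clique2 // cards2 xy.
  exists x; apply/existsP; exists y; rewrite /compl_graph xy AE eqxx /= andbT.
  by rewrite -(clique2 adj_sym xy) -AE.
by rewrite PoszD [X in X - _]addrC addrK.
Qed.

Lemma tauE k j : #|X| = (k + 2 + j)%N -> (0 < j)%N ->
  tau S k%:Z = partial_tau S j (size S).
Proof.
move=> cardX j_gt0; rewrite /tau /partial_tau (union_upto_size S_leaf) cardsT /=.
have -> : #|X|%:Z - k%:Z - 2 = j%:Z by lia.
congr (_ - _ + _).
- have -> : #|X|%:Z - 1 = (k + 1 + j)%:Z by lia.
  have -> : k%:Z + 1 = (k + 1)%N%:Z by lia.
  have -> : #|X|.-1 = (k + 1 + j)%N by lia.
  by rewrite /= -bin_sub ?leq_addr // addKn.
- by rewrite (big_nth set0); apply: eq_bigr => i _; rewrite binz_pred.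
by apply: eq_bigr => i _; rewrite binz_pred.
Qed.

Hypothesis S_gt1 : (1 < size S)%N.

Lemma valuation_cliques (V : zmodType) (w : {set X} -> V) :
  \sum_(C in Delta) w C
    = \sum_(0 <= i < size S) \sum_(C in powerset (Snth i)) w C
      - \sum_(1 <= i < size S) \sum_(C in powerset (sep i)) w C.
Proof.
rewrite -(faces_upto_size S_leaf); apply: valuation_faces_upto.
  exact: leaf_order_sequence S_leaf.
by rewrite (ltnW S_gt1) leqnn.
Qed.

Lemma card_cliques j : #|[set C in Delta | #|C| == j]|%:Z
  = \sum_(0 <= i < size S) 'C(#|Snth i|, j)%:Z
    - \sum_(1 <= i < size S) 'C(#|sep i|, j)%:Z.
Proof.
have -> : #|[set C in Delta | #|C| == j]|%:Z = \sum_(C in Delta) (#|C| == j)%:R.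
  rewrite -natz -sum1_card natr_sum [LHS]big_mkcond [RHS]big_mkcond /=.
  by apply: eq_bigr => C _; rewrite in_set; case: (_ \in Delta) => //; case: eqP.
rewrite valuation_cliques; congr (_ - _).
  by apply: eq_bigr => i _; rewrite sum_powerset_card.
by apply: eq_bigr => i _; rewrite sum_powerset_card.
Qed.

Lemma card_vertices : #|X|%:Z
  = \sum_(0 <= i < size S) #|Snth i|%:Z - \sum_(1 <= i < size S) #|sep i|%:Z.
Proof.
have := card_cliques 1; under eq_bigr do rewrite bin1.
under [X in _ = _ - X -> _]eq_bigr do rewrite bin1.
move=> <-; rewrite -[#|X|]bin1 -card_draws; congr (_ %:Z); apply: eq_card => C.
rewrite [LHS]inE [RHS]inE; case: cards1P => [[x ->] | _]; last by rewrite andbF.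
by rewrite clique1.
Qed.

(** For N - k - 2 = 2 write C(x - 1, 2) = C(x, 2) - x + 1 - [x = 0]. The terms
    C(x, 2) count edges, the terms x count vertices, and the corrections [x = 0] count
    the empty separators, which are the components but the first. *)
Lemma tau_eq_edges : (4 <= #|X|)%N -> tau S (#|X|%:Z - 4)
  = #|edges (compl_graph adj)|%:Z - (num_components adj)%:Z + 1.
Proof.
move=> X_ge4; have -> : #|X|%:Z - 4 = (#|X| - 4)%N%:Z by lia.
rewrite (@tauE _ 2) //; last by lia.
rewrite card_compl_edges card_cliques (num_components_leaf_order adj_sym S_leaf S_gt1).
have binE (x : nat) : 'C(x.-1, 2)%:Z = 'C(x, 2)%:Z - x%:Z + 1 - (x == 0%N)%:Z.
  by case: x => // x; rewrite binS bin1 /=; lia.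
rewrite /partial_tau (union_upto_size S_leaf) cardsT binE.
under eq_big_nat => i lti.
  rewrite binE cards_eq0 (negPf (facet_neq0 S_leaf S_gt1 (andP lti).2)) subr0.
  over.
under [X in _ + X]eq_bigr do rewrite binE cards_eq0.
rewrite !(big_split, sumrN) /= !sumr_const_nat.
have -> : (#|[set l : 'I_(size S) | starts_component S l]|%:Z
    = 1 + \sum_(1 <= i < size S) (sep i == set0)%:Z).
  rewrite -natz -sum1_card natr_sum big_mkcond /=.
  have -> : \sum_(l < size S) (if l \in [set l : 'I_(size S) | starts_component S l]
      then 1 else 0) = \sum_(0 <= l < size S) (starts_component S l)%:Z :> int.
    by rewrite big_mkord; apply: eq_bigr => l _; rewrite inE; case: (starts_component _ _).
  rewrite [LHS]big_ltn ?(ltnW S_gt1) //.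
  congr (_ + _); apply: eq_big_nat => -[|l] //.
have := card_vertices; have -> : (#|X| == 0%N) = false by apply/eqP; lia.
rewrite !natz /=.
set z := \sum_(1 <= i < size S) (sep i == set0)%:Z.
set a := \sum_(1 <= i < size S) #|sep i|%:Z.
set b := \sum_(0 <= i < size S) #|Snth i|%:Z.
set c := \sum_(0 <= i < size S) _; set d := \sum_(1 <= i < size S) _.
move: a b c d z 'C(#|X|, 2) => a b c d z e; lia.
Qed.

(** The sum over the skeleton of the dual is the sum of [skeleton_sign] over all
    subsets minus that over the cliques, which is a valuation. *)
Lemma top_h_skeleton k j : #|X| = (k + 2 + j)%N -> (0 < j)%N ->
  top_h (skeleton (alexander_dual Delta) k%:Z) k.+1 = partial_tau S j (size S).
Proof.
move=> cardX j_gt0; rewrite /top_h /partial_tau (union_upto_size S_leaf).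
have signE (C : {set X}) : (if (#|~: C|%:Z - 1 <= k%:Z) then (-1) ^+ (k.+1 - #|~: C|) else 0)
    = skeleton_sign j C :> int.
  rewrite /skeleton_sign; have cC := cardsC C.
  have -> : (#|~: C|%:Z - 1 <= k%:Z) = (j < #|C|)%N by apply/idP/idP; lia.
  by case: ifP => // ltj; congr (_ ^+ _); lia.
have := valuation_cliques (skeleton_sign j).
rewrite (eq_bigr _ (fun i _ => sum_skeleton_sign (Snth i) j_gt0)).
rewrite (eq_bigr _ (fun i _ => sum_skeleton_sign (sep i) j_gt0)) => valuation.
rewrite -addrA [- _ + _]addrC -opprB -valuation -(sum_skeleton_sign _ j_gt0).
apply/eqP; rewrite eq_sym subr_eq; apply/eqP.
rewrite (bigID (mem Delta)) /= addrC; congr (_ + _); last first.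
  by apply: eq_bigl => C; rewrite !inE subsetT.
rewrite (reindex_inj (@setC_inj X)) /= [RHS]big_mkcond [LHS]big_mkcond.
apply: eq_bigr => C _; rewrite -signE setCK !inE subsetT /=.
by case: (~~ _).
Qed.

End FaceNumbers.

(** * The equivalences *)

Section Dual.
Variables (K : fieldType) (X : finType) (adj : rel X).
Hypothesis adj_sym : ssrbool.symmetric adj.
Hypothesis adj_irr : irreflexive adj.

Local Notation Delta := (clique_complex adj).
Local Notation dual := (alexander_dual Delta).

Lemma in_dual F : (F \in dual) = (~: F \notin Delta).
Proof. by rewrite [LHS]in_set. Qed.

Lemma in_skeleton (Sigma : {set {set X}}) (k : int) (F : {set X}) :
  (F \in skeleton Sigma k) = (F \in Sigma) && (#|F|%:Z - 1 <= k).
Proof. by rewrite [LHS]in_set. Qed.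

Lemma skeleton_down (k : int) : down_closed (skeleton dual k).
Proof.
move=> F A; rewrite !in_skeleton !in_dual => /andP[nF leF] AF; apply/andP; split.
  by apply: contra nF => /clique_sub; apply; rewrite setCS.
have := subset_leq_card AF; lia.
Qed.

Lemma skeleton_boundary (V : {set X}) (k : int) : #|V|%:Z = #|X|%:Z - 2 -> k = #|X|%:Z - 4 ->
  dual = simplex_on V -> skeleton dual k = simplex_boundary V.
Proof.
move=> cV -> dualV; apply/setP => F; rewrite in_skeleton dualV [RHS]in_setD1 -/(simplex_on V) andbC.
have [FV | _] := boolP (F \in simplex_on V); last by rewrite !andbF.
rewrite !andbT.
rewrite inE in FV; rewrite eqEcard FV /=; move: (subset_leq_card FV) cV.
by move: #|F| #|V| #|X| => f v x le cV; apply/idP/idP; lia.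
Qed.

Lemma simplex_dual_graph (V : {set X}) (k : int) : 0 <= k -> k < #|X|%:Z - 3 ->
  #|V|%:Z = #|X|%:Z - 2 -> dual = simplex_on V -> skeleton dual k = simplex_boundary V ->
  k = #|X|%:Z - 4 /\ exists u v : X, u != v /\
    forall x y, adj x y = (x != y) && ([set x; y] != [set u; v]).
Proof.
move=> k_ge0 ltk cV dualV skelV; split.
  have [x xV] : exists x, x \in V by apply/card_gt0P; lia.
  have : V :\ x \in skeleton dual k.
    rewrite skelV in_setD1 inE subD1set andbT; apply/eqP => E.
    by move: xV; rewrite -E !inE eqxx.
  by rewrite in_skeleton => /andP[_]; have := cardsD1 x V; rewrite xV; lia.
have /cards2P[u [v [uv uvE]]] : #|~: V| == 2%N by apply/eqP; have := cardsC V; lia.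
exists u, v; split=> // x y; have [-> | xy] := eqVneq x y; first by rewrite adj_irr.
rewrite -(clique2 adj_sym xy) /=.
have -> : ([set x; y] \in Delta) = (~: [set x; y] \notin dual).
  by rewrite in_dual setCK negbK.
rewrite dualV inE -[V]setCK setCS uvE; congr (~~ _).
by rewrite eq_sym eqEcard !cards2 uv xy andbT.
Qed.

(** The skeleton is the boundary of the simplex on all vertices but u and v. *)
Lemma missing_edge_gorenstein (u v : X) (k : int) : u != v -> 0 <= k -> k = #|X|%:Z - 4 ->
  (forall x y, adj x y = (x != y) && ([set x; y] != [set u; v])) ->
  gorenstein (sr_ideal K (skeleton dual k)).
Proof.
move=> uv k_ge0 kE adjE; pose V := ~: [set u; v].
have cV : #|V|%:Z = #|X|%:Z - 2 by have := cardsC [set u; v]; rewrite cards2 uv /V; lia.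
have dualV : dual = simplex_on V.
  have clE (C : {set X}) : (C \in Delta) = ~~ ([set u; v] \subset C).
    apply/cliqueP/idP => [cl | nuv x y xC yC xy].
      apply/negP; rewrite subUset !sub1set => /andP[uC vC].
      by have := cl u v uC vC uv; rewrite adjE eqxx andbF.
    rewrite adjE xy; apply: contra nuv => /eqP<-.
    by rewrite subUset !sub1set xC.
  by apply/setP => F; rewrite in_dual clE negbK [RHS]inE /V -setCS setCK.
rewrite (skeleton_boundary cV kE dualV).
have [x xV] : exists x, x \in V by apply/card_gt0P; lia.
exact: gorenstein_boundary xV.
Qed.

End Dual.

Section Equivalences.
Variables (K : fieldType) (X : finType) (adj : rel X) (S : seq {set X}).
Hypothesis S_leaf : leaf_order (clique_complex adj) S.
Hypothesis S_gt1 : (1 < size S)%N.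

Local Notation Delta := (clique_complex adj).
Local Notation dual := (alexander_dual Delta).
Local Notation Snth m := (nth set0 S m).

Lemma tau_lower k j : #|X| = (k + 2 + j.+2)%N ->
  'C(#|X| - 3, j)%:Z <= tau S k%:Z.
Proof.
move=> cardX; rewrite (tauE S_leaf cardX) // -[#|X|]cardsT -(union_upto_size S_leaf).
apply: partial_tau_lower => //.
- exact: leaf_order_sequence S_leaf.
- by move=> i i'; apply: facet_irredundant S_leaf _ _.
by rewrite (union_upto_size S_leaf) cardsT; lia.
Qed.

Lemma tau_gt0 k j : #|X| = (k + 2 + j.+2)%N -> 0 < tau S k%:Z.
Proof.
move=> cardX; have := tau_lower cardX.
have : (0 < 'C(#|X| - 3, j))%N by rewrite bin_gt0; lia.
lia.
Qed.

(** The type is at least tau by [cm_type_bound], and tau is positive. *)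
Lemma gorenstein_tau k j : #|X| = (k + 2 + j.+2)%N ->
  gorenstein (sr_ideal K (skeleton dual k%:Z)) -> tau S k%:Z = 1.
Proof.
move=> cardX; have t_gt0 := tau_gt0 cardX.
have dimG F : F \in skeleton dual k%:Z -> (#|F| <= k.+1)%N.
  by rewrite in_skeleton => /andP[_]; lia.
move=> /(cm_type_bound (@skeleton_down _ adj k%:Z) dimG).
rewrite (top_h_skeleton S_leaf S_gt1 cardX) // -(tauE S_leaf cardX) //.
have t_neq0 : tau S k%:Z != 0 by lia.
by move=> /(_ t_neq0); lia.
Qed.

Lemma tau_eq1_facets (k : int) : 0 <= k -> k < #|X|%:Z - 3 -> tau S k = 1 ->
  [/\ k = #|X|%:Z - 4, size S = 2%N,
      #|Snth 0|%:Z = #|X|%:Z - 1, #|Snth 1|%:Z = #|X|%:Z - 1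
    & #|separator S 1|%:Z = #|X|%:Z - 2].
Proof.
case: k => // k _ ltk t1; have cardX : #|X| = (k + 2 + (#|X| - k - 4).+2)%N by lia.
have := tau_lower cardX; rewrite t1.
have [j0 _ | j_gt0] := posnP (#|X| - k - 4); last first.
  have := @bin_ge2 (#|X| - 3) (#|X| - k - 4); lia.
rewrite j0 in cardX; rewrite (tauE S_leaf cardX) // in t1.
have [] := partial_tau_eq1 (leaf_order_sequence S_leaf) _ S_gt1 _ t1.
- by move=> i i'; apply: facet_irredundant S_leaf _ _.
- by rewrite (union_upto_size S_leaf) cardsT; lia.
rewrite (union_upto_size S_leaf) cardsT => -> -> -> ->; split=> //; lia.
Qed.

Lemma two_facets_dual : size S = 2%N -> (4 <= #|X|)%N ->
  #|Snth 0|%:Z = #|X|%:Z - 1 -> #|Snth 1|%:Z = #|X|%:Z - 1 ->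
  #|separator S 1|%:Z = #|X|%:Z - 2 -> dual = simplex_on (separator S 1).
Proof.
move=> S2 X_ge4 n0 n1 r1; apply/setP => F; rewrite in_dual [RHS]inE.
have sepE : separator S 1 = Snth 0 :&: Snth 1.
  by rewrite /separator (take_nth set0) ?take0 ?S2 //= big_seq1.
have subE (T : {set X}) : #|T|%:Z = #|X|%:Z - 1 -> (~: F \subset T) = ~~ (F \subset T).
  move=> cT; have /cards1P[u uE] : #|~: T| == 1%N.
    by apply/eqP; have := cardsC T; lia.
  by rewrite -[~: F \subset T]setCS setCK -[F \subset T]setCS uE !sub1set inE negbK.
rewrite sepE subsetI; have [F0 F1] := (subE _ n0, subE _ n1).
transitivity (~~ ((~: F \subset Snth 0) || (~: F \subset Snth 1))); last first.
  by rewrite F0 F1 negb_or !negbK.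
congr (~~ _); apply/idP/idP => [/(facet_cover S_leaf)[m] | ].
  by rewrite S2; case: m => [|[|m]] // _ ->; rewrite ?orbT.
by case/orP => sub; apply: clique_sub sub; apply: facet_clique S_leaf _ _; rewrite S2.
Qed.

End Equivalences.

Theorem corollary14 (K : fieldType) (X : finType) (adj : rel X)
  (adj_sym : ssrbool.symmetric adj) (adj_irr : irreflexive adj)
  (adj_chordal : chordal adj)
  (two_facets : (2 <= #|facets (clique_complex adj)|)%N)
  (S : seq {set X}) (S_leaf : leaf_order (clique_complex adj) S) :
  let N := #|X|%:Z in
  let dual := alexander_dual (clique_complex adj) in
  [/\ forall k : int, 0 <= k -> k <= N - 5 ->
        binz (N - 3) (k + 1) <= tau S k /\ 2 <= binz (N - 3) (k + 1),
      4 <= N ->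
        tau S (N - 4)
        = #|edges (compl_graph adj)|%:Z - (num_components adj)%:Z + 1,
      forall k : int, 0 <= k -> k < N - 3 ->
        [<-> gorenstein (sr_ideal K (skeleton dual k));
             tau S k = 1;
             [/\ k = N - 4, size S = 2%N,
                 #|nth set0 S 0|%:Z = N - 1, #|nth set0 S 1|%:Z = N - 1
               & #|separator S 1|%:Z = N - 2];
             exists V : {set X},
               [/\ #|V|%:Z = N - 2, dual = simplex_on V,
                   forall x, x \notin V -> ghost dual x
                 & skeleton dual k = simplex_boundary V];
             k = N - 4 /\
               exists u v : X, u != v /\
                 forall x y, adj x y = (x != y) && ([set x; y] != [set u; v])]
    & forall k : int, 0 <= k -> k < N - 3 ->
        ~ gorenstein (sr_ideal K (skeleton dual k)) -> 2 <= tau S k].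
Proof.
move=> N dual.
have S_gt1 : (1 < size S)%N by rewrite (size_facets S_leaf).
have sizes k : (0 : int) <= k -> k < N - 3 -> exists k' j : nat,
    k = k'%:Z /\ #|X| = (k' + 2 + j.+2)%N.
  case: k => // k _ ltk; exists k, (#|X| - k - 4)%N; split=> //.
  by rewrite /N in ltk; lia.
have equiv k : 0 <= k -> k < N - 3 ->
    [<-> gorenstein (sr_ideal K (skeleton dual k));
         tau S k = 1;
         [/\ k = N - 4, size S = 2%N,
             #|nth set0 S 0|%:Z = N - 1, #|nth set0 S 1|%:Z = N - 1
           & #|separator S 1|%:Z = N - 2];
         exists V : {set X},
           [/\ #|V|%:Z = N - 2, dual = simplex_on V,
               forall x, x \notin V -> ghost dual x
             & skeleton dual k = simplex_boundary V];
         k = N - 4 /\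
           exists u v : X, u != v /\
             forall x y, adj x y = (x != y) && ([set x; y] != [set u; v])].
  move=> k_ge0 ltk; tfae.
  - have [k' [j [-> cardX]]] := sizes k k_ge0 ltk.
    exact: (gorenstein_tau S_leaf S_gt1 cardX).
  - exact: (tau_eq1_facets S_leaf S_gt1).
  - case=> kE S2 n0 n1 r1; exists (separator S 1).
    have dualV : dual = simplex_on (separator S 1).
      by apply: (two_facets_dual S_leaf S_gt1 S2) => //; rewrite /N in kE; lia.
    split=> // [x xV F|]; last exact: skeleton_boundary r1 kE dualV.
    by rewrite dualV inE => /subsetP FV; apply: contra xV; apply: FV.
  - case=> V [cV dualV _ skelV].
    exact: (simplex_dual_graph adj_sym adj_irr k_ge0 ltk cV dualV skelV).
  case=> kE [u [v [uv adjE]]].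
  exact: (missing_edge_gorenstein K uv k_ge0 kE adjE).
split=> [k k_ge0 lek | N_ge4 | // | k k_ge0 ltk ngor].
- have ltk : k < N - 3 by move: lek; rewrite /N; lia.
  have [k' [j [kE cardX]]] := sizes k k_ge0 ltk; subst k.
  have -> : binz (N - 3) (k'%:Z + 1) = 'C(#|X| - 3, j)%:Z.
    have -> : N - 3 = (#|X| - 3)%N%:Z by rewrite /N; lia.
    have -> : k'%:Z + 1 = (k' + 1)%N%:Z by lia.
    have le : (k' + 1 <= #|X| - 3)%N by rewrite cardX; lia.
    by rewrite /= -(bin_sub le) cardX; congr ('C(_, _)%:Z); lia.
  split; first exact: (tau_lower S_leaf S_gt1 cardX).
  by rewrite lez_nat; apply: bin_ge2; rewrite /N in lek; lia.
- by apply: (tau_eq_edges adj_sym S_leaf S_gt1); rewrite /N in N_ge4; lia.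
have t_neq1 : tau S k <> 1 by move/((equiv k k_ge0 ltk) 1%N 0%N).
have [k' [j [kE cardX]]] := sizes k k_ge0 ltk; subst k.
have := tau_gt0 S_leaf S_gt1 cardX; lia.
Qed.
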